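(* Let $(R,\mathfrak{m},k)$ be a complete Cohen-Macaulay local ring with canonical module $\Omega$. Then $\mathrm{Hom}_R(-,\Omega)$ is an endofunctor on $\varinjlim\mathrm{CM}(R)$ (that is, $\mathrm{Hom}_R(M,\Omega)\in\varinjlim\mathrm{CM}(R)$ for every $M\in\varinjlim\mathrm{CM}(R)$), and $\Omega$ is an injective object in $\varinjlim\mathrm{CM}(R)$.
   Context: Cohen-Macaulay local rings are commutative and Noetherian; write $d=\dim R$. $\mathrm{CM}(R)$ is the class of finitely generated $R$-modules $M$ with $\mathrm{Ext}_R^i(k,M)=0$ for all $i<d$ (the zero module included), and $\varinjlim\mathrm{CM}(R)$ is the class of all $R$-modules that are direct limits of directed systems of modules in $\mathrm{CM}(R)$. The canonical module $\Omega$ is the (unique up to isomorphism) module in $\mathrm{CM}(R)$ with $\dim_k\mathrm{Ext}_R^i(k,\Omega)=0$ for $i\ne d$ and $=1$ for $i=d$; it exists since $R$ is complete. ''Injective object'' is with respect to the exact structure inherited from all $R$-modules: for every short exact sequence $0\to L\to M\to N\to 0$ of $R$-modules with $L,M,N\in\varinjlim\mathrm{CM}(R)$, the map $\mathrm{Hom}_R(M,\Omega)\to\mathrm{Hom}_R(L,\Omega)$ is surjective. *)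

(* Defs.v *)
From HB Require Import structures.
From mathcomp Require Import all_boot all_algebra.
From mathcomp Require Import finmap boolp.
From mathcomp.multinomials Require Import monalg.

(* boolp puts choiceType structures on arbitrary types and turns propositions
   into booleans, so boolean submodules and ideals are arbitrary ones; the free
   R-module on the set K is {malg R[K]}. *)

Set Implicit Arguments.
Unset Strict Implicit.
Unset Printing Implicit Defensive.

Import GRing.Theory.
Local Open Scope ring_scope.
Local Open Scope quotient_scope.

Record submodule (R : comNzRingType) (V : lmodType R) := Submodule {
  submod_pred :> V -> bool;
  submod_predP : submod_closed (submod_pred : {pred V})
}.

Section SubmoduleTheory.
Variables (R : comNzRingType) (V : lmodType R) (S : submodule V).

HB.instance Definition _ := GRing.isZmodClosed.Build V (submod_pred S)
  (GRing.submod_closedB (submod_predP S)).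
HB.instance Definition _ := GRing.isScaleClosed.Build R V (submod_pred S)
  (GRing.submod_closed_semi (submod_predP S)).2.

Record submod : Type := Submod {
  submod_val : V;
  submod_valP : submod_val \in (submod_pred S : {pred V})
}.

HB.instance Definition _ := [isSub for submod_val].
HB.instance Definition _ := [Choice of submod by <:].
HB.instance Definition _ := [SubChoice_isSubLmodule of submod by <:].

Lemma submod_val_linear : linear submod_val.
Proof. by []. Qed.

HB.instance Definition _ := GRing.isLinear.Build R submod V _ submod_val
  submod_val_linear.

Local Notation Q := (Quotient.quot ((submod_pred S : {pred V}) : zmodClosed V)).

Definition quotmod : Type := Q.

HB.instance Definition _ := GRing.Zmodule.on quotmod.

Definition quotmod_pi (v : V) : quotmod :=
  \pi_Q v.

Definition quotmod_scale (a : R) (x : quotmod) : quotmod :=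
  quotmod_pi (a *: repr (x : Q)).

Lemma quotmod_piZ a v : quotmod_scale a (quotmod_pi v) = quotmod_pi (a *: v).
Proof.
rewrite /quotmod_scale /quotmod_pi; apply/eqP.
rewrite -Quotient.idealrBE -scalerBr; apply: (GRing.submod_closed_semi (submod_predP S)).2.
by rewrite Quotient.idealrBE reprK.
Qed.

Lemma quotmod_piD v w : quotmod_pi (v + w) = quotmod_pi v + quotmod_pi w.
Proof. by rewrite /quotmod_pi raddfD. Qed.

Lemma quotmod_piP (x : quotmod) : exists v, x = quotmod_pi v.
Proof.
exists (repr (x : Q)).
by rewrite /quotmod_pi reprK.
Qed.

Lemma quotmod_scaleA a b x :
  quotmod_scale a (quotmod_scale b x) = quotmod_scale (a * b) x.
Proof. by have [v ->] := quotmod_piP x; rewrite !quotmod_piZ scalerA. Qed.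

Lemma quotmod_scale1 : left_id 1 quotmod_scale.
Proof. by move=> x; have [v ->] := quotmod_piP x; rewrite quotmod_piZ scale1r. Qed.

Lemma quotmod_scaleDr : right_distributive quotmod_scale +%R.
Proof.
move=> a x y; have [v ->] := quotmod_piP x; have [w ->] := quotmod_piP y.
by rewrite -quotmod_piD !quotmod_piZ scalerDr quotmod_piD.
Qed.

Lemma quotmod_scaleDl x : {morph quotmod_scale^~ x : a b / a + b}.
Proof.
move=> a b; have [v ->] := quotmod_piP x.
by rewrite !quotmod_piZ scalerDl quotmod_piD.
Qed.

HB.instance Definition _ := GRing.Zmodule_isLmodule.Build R quotmod
  quotmod_scaleA quotmod_scale1 quotmod_scaleDr quotmod_scaleDl.

End SubmoduleTheory.

Section HomModule.
Variables (R : comNzRingType) (U V : lmodType R).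

Definition homR : Type := {linear U -> V}.

HB.instance Definition _ := gen_eqMixin homR.
HB.instance Definition _ := gen_choiceMixin homR.

Lemma homR_eq (f g : homR) : (forall x, f x = g x) -> f = g.
Proof.
case: f g => [f [[Df] [Zf]]] [g [[Dg] [Zg]]] /= /funext fg.
subst g; by rewrite (Prop_irrelevance Df Dg) (Prop_irrelevance Zf Zg).
Qed.

Definition homR_zero : homR := (\0 : U -> V).
Definition homR_opp (f : homR) : homR := (\- f : U -> V).
Definition homR_add (f g : homR) : homR := (f \+ g : U -> V).
Definition homR_scale (a : R) (f : homR) : homR := (a \*: f : U -> V).

Lemma homR_addA : associative homR_add.
Proof. by move=> f g h; apply: homR_eq => x /=; rewrite addrA. Qed.

Lemma homR_addC : commutative homR_add.
Proof. by move=> f g; apply: homR_eq => x /=; rewrite addrC. Qed.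

Lemma homR_add0 : left_id homR_zero homR_add.
Proof. by move=> f; apply: homR_eq => x /=; rewrite add0r. Qed.

Lemma homR_addN : left_inverse homR_zero homR_opp homR_add.
Proof. by move=> f; apply: homR_eq => x /=; rewrite addNr. Qed.

HB.instance Definition _ := GRing.isZmodule.Build homR
  homR_addA homR_addC homR_add0 homR_addN.

Lemma homR_scaleA a b f : homR_scale a (homR_scale b f) = homR_scale (a * b) f.
Proof. by apply: homR_eq => x /=; rewrite scalerA. Qed.

Lemma homR_scale1 : left_id 1 homR_scale.
Proof. by move=> f; apply: homR_eq => x /=; rewrite scale1r. Qed.

Lemma homR_scaleDr : right_distributive homR_scale +%R.
Proof. by move=> a f g; apply: homR_eq => x /=; rewrite scalerDr. Qed.

Lemma homR_scaleDl f : {morph homR_scale^~ f : a b / a + b}.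
Proof. by move=> a b; apply: homR_eq => x /=; rewrite scalerDl. Qed.

HB.instance Definition _ := GRing.Zmodule_isLmodule.Build R homR
  homR_scaleA homR_scale1 homR_scaleDr homR_scaleDl.

End HomModule.

Section FreeCover.
Variables (R : comNzRingType) (N : lmodType R).
Local Open Scope fset_scope.

(* The map R^(N) -> N sending the basis vector indexed by x to x. *)
Definition free_cover (g : {malg R[N]}) : N := \sum_(x <- msupp g) g@_x *: x.

Lemma free_coverE (D : {fset N}) (g : {malg R[N]}) : msupp g `<=` D ->
  free_cover g = \sum_(x <- D) g@_x *: x.
Proof.
move=> gD; apply: big_fset_incl => // x _ /mcoeff_outdom ->.
by rewrite scale0r.
Qed.

Lemma free_cover_linear : linear free_cover.
Proof.
move=> a g h; pose D := msupp g `|` msupp h.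
have gD : msupp g `<=` D by apply: fsubsetUl.
have hD : msupp h `<=` D by apply: fsubsetUr.
have ghD : msupp (a *: g + h) `<=` D.
  apply: fsubset_trans (msuppD_le _ _) _; apply: fsetSU; exact: msuppZ_le.
rewrite (free_coverE gD) (free_coverE hD) (free_coverE ghD).
rewrite scaler_sumr -big_split /=; apply: eq_bigr => x _.
by rewrite mcoeffD mcoeffZ scalerDl scalerA.
Qed.

HB.instance Definition _ := GRing.isLinear.Build R {malg R[N]} N _ free_cover
  free_cover_linear.
End FreeCover.

Section Kernel.
Variables (R : comNzRingType) (U V : lmodType R) (f : {linear U -> V}).

Lemma ker_closed : submod_closed [pred u | f u == 0].
Proof.
split=> [|a u v]; rewrite !inE ?linear0 // => /eqP fu /eqP fv.
by rewrite linearP fu fv scaler0 addr0.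
Qed.

Definition ker_submodule : submodule U := Submodule ker_closed.
End Kernel.

(* The functorial free resolution of N: with N_0 = N and N_(i+1) the kernel of
   R^(N_i) -> N_i, its i-th term is R^(N_i), and the differential is
   R^(N_(i+1)) -> N_(i+1) -> R^(N_i). *)
Section Resolution.
Variables (R : comNzRingType) (N : lmodType R).

Fixpoint syzygy (i : nat) : lmodType R :=
  if i is j.+1 then submod (ker_submodule (@free_cover R (syzygy j))) else N.

Definition free_res (i : nat) : lmodType R := {malg R[syzygy i]}.

Definition free_res_diff (i : nat) : {linear free_res i.+1 -> free_res i} :=
  (@submod_val R (free_res i) (ker_submodule (@free_cover R (syzygy i)))
     \o @free_cover R (syzygy i.+1) : free_res i.+1 -> free_res i).
End Resolution.

Section Ext.
Variables (R : comNzRingType) (N M : lmodType R).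

Definition cochain (i : nat) : lmodType R := homR (free_res N i) M.

Definition codiff (i : nat) (f : cochain i) : cochain i.+1 :=
  ((f : homR _ _) \o @free_res_diff R N i : free_res N i.+1 -> M).

Lemma codiff_linear i : linear (@codiff i).
Proof. by move=> a f g; apply: homR_eq. Qed.

HB.instance Definition _ i := GRing.isLinear.Build R (cochain i) (cochain i.+1)
  _ (@codiff i) (@codiff_linear i).

Definition cocycle (i : nat) : submodule (cochain i) := ker_submodule (@codiff i).

Definition is_coboundary (i : nat) : cochain i -> Prop :=
  if i is j.+1 then fun f => exists g : cochain j, f = codiff g
  else fun f => f = 0.

Lemma coboundary_closed i :
  submod_closed [pred f : submod (cocycle i) | `[< is_coboundary (submod_val f) >]].
Proof.
split=> [|a u v]; rewrite !inE.
  by apply/asboolP; case: i => [|i] //=; exists 0; rewrite linear0.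
move=> /asboolP + /asboolP; case: i u v => [|i] u v /= Bu Bv; apply/asboolP.
  by rewrite /= Bu Bv scaler0 addr0.
have [[f uf] [g vg]] := (Bu, Bv).
by exists (a *: f + g); rewrite codiff_linear -uf -vg.
Qed.

Definition coboundary (i : nat) : submodule (submod (cocycle i)) :=
  Submodule (@coboundary_closed i).

Definition Ext (i : nat) : lmodType R := quotmod (coboundary i).
End Ext.

Section LocalRings.
Variable R : comNzRingType.

Definition fin_gen (M : lmodType R) : Prop :=
  exists n (g : 'I_n -> M), forall x, exists r : 'I_n -> R,
    x = \sum_(i < n) r i *: g i.

Definition noetherian : Prop := forall I : submodule R^o, fin_gen (submod I).

Definition maximal_ideal (m : idealr R) : Prop :=
  forall I : idealr R, {subset m <= I} -> {subset I <= m}.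

Definition local_ring (m : idealr R) : Prop :=
  maximal_ideal m /\ forall n : idealr R, maximal_ideal n -> n =i m.

Definition prime_chain (n : nat) (p : 'I_n.+1 -> prime_idealr R) : Prop :=
  forall i j : 'I_n.+1, (i < j)%N ->
    {subset p i <= p j} /\ ~ {subset p j <= p i}.

Definition krull_dim (d : nat) : Prop :=
  (exists p, @prime_chain d p) /\
  (forall n p, @prime_chain n p -> (n <= d)%N).

Variable m : idealr R.

Definition ideal_pow (n : nat) (x : R) : Prop :=
  exists k (r : 'I_k -> R) (a : 'I_k -> 'I_n -> R),
    (forall i j, a i j \in m) /\ x = \sum_(i < k) r i * \prod_(j < n) a i j.

(* Bijectivity of R -> lim_n R/m^n; a sequence x with x_(n+1) = x_n mod m^n
   represents a point of the inverse limit. *)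
Definition adic_complete : Prop :=
  forall x : nat -> R, (forall n, ideal_pow n (x n.+1 - x n)) ->
    exists! y, forall n, ideal_pow n (y - x n).

Lemma ideal_submod_closed : submod_closed ((m : {pred R}) : {pred R^o}).
Proof.
split=> [|a u v mu mv]; first exact: idealr0.
by apply: rpredD => //; apply: idealMr.
Qed.

Definition residue_field : lmodType R := quotmod (Submodule ideal_submod_closed).

(* V has dimension n over k = R/m: it is killed by m (the "if" part of the
   equivalence) and has a k-basis e_0, ..., e_(n-1); scalars are written
   through representatives in R. *)
Definition residue_dim (V : lmodType R) (n : nat) : Prop :=
  exists e : 'I_n -> V,
    (forall x, exists r : 'I_n -> R, x = \sum_(i < n) r i *: e i) /\
    (forall r : 'I_n -> R,
       \sum_(i < n) r i *: e i = 0 <-> (forall i, r i \in m)).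

(* d stands for dim R. *)
Variable d : nat.

Definition CM_module (M : lmodType R) : Prop :=
  fin_gen M /\ forall i, (i < d)%N -> forall x : Ext residue_field M i, x = 0.

Definition canonical_module (W : lmodType R) : Prop :=
  CM_module W /\
  forall i, residue_dim (Ext residue_field W i) (if i == d then 1 else 0)%N.

End LocalRings.

Section DirectLimits.
Variable R : comNzRingType.

Record direct_system := DirectSystem {
  ds_index : Type;
  ds_le : ds_index -> ds_index -> Prop;
  ds_le_refl : forall i, ds_le i i;
  ds_le_trans : forall i j k, ds_le i j -> ds_le j k -> ds_le i k;
  ds_inhabited : inhabited ds_index;
  ds_directed : forall i j, exists k, ds_le i k /\ ds_le j k;
  ds_obj :> ds_index -> lmodType R;
  ds_map : forall i j, ds_le i j -> {linear ds_obj i -> ds_obj j};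
  ds_map_id : forall i (h : ds_le i i) x, ds_map h x = x;
  ds_map_comp : forall i j k (ij : ds_le i j) (jk : ds_le j k) (ik : ds_le i k) x,
    ds_map jk (ds_map ij x) = ds_map ik x
}.

Definition is_cocone (D : direct_system) (M : lmodType R)
    (g : forall i, {linear D i -> M}) : Prop :=
  forall i j (h : ds_le i j) x, g j (ds_map h x) = g i x.

Definition is_direct_limit (D : direct_system) (M : lmodType R)
    (g : forall i, {linear D i -> M}) : Prop :=
  is_cocone g /\
  forall (Y : lmodType R) (t : forall i, {linear D i -> Y}), is_cocone t ->
    exists! u : {linear M -> Y}, forall i x, u (g i x) = t i x.

Definition direct_limits (C : lmodType R -> Prop) (M : lmodType R) : Prop :=
  exists (D : direct_system) (g : forall i, {linear D i -> M}),
    (forall i, C (D i)) /\ is_direct_limit g.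

Definition short_exact (L M N : lmodType R)
    (f : {linear L -> M}) (g : {linear M -> N}) : Prop :=
  [/\ injective f, forall y, g y = 0 <-> exists x, f x = y
    & forall z, exists y, g y = z].

(* E is an injective object of the full subcategory C of R-modules, for the
   exact structure inherited from all R-modules. *)
Definition injective_object (C : lmodType R -> Prop) (E : lmodType R) : Prop :=
  C E /\
  forall (L M N : lmodType R) (f : {linear L -> M}) (g : {linear M -> N}),
    C L -> C M -> C N -> short_exact f g ->
    forall h : {linear L -> E}, exists h' : {linear M -> E},
      forall x, h' (f x) = h x.

End DirectLimits.

Definition lim_CM (R : comNzRingType) (m : idealr R) (d : nat) :
  lmodType R -> Prop := direct_limits (CM_module m d).

(* Main.v *)
(** The functor M^* = Hom(M, Omega) and the class lim CM are studied through
    Lenzing's criterion: M is a direct limit of modules in CM exactly when every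
    map from a finitely generated module to M factors through a module in CM.

    Ext(X, Omega) vanishes in positive degrees for X in CM. The finite injective
    dimension of Omega follows from Ext^i(k, Omega) = 0 for i > d by Noetherian
    induction on ideals I, applied to R/I. For X in CM, let Q -> R -> k be the
    start of a free resolution of k; the map X -> Hom(Q, X) is injective with
    entries in m, and dimension shifting along Hom(-, X) shows that Ext^2 of its
    cokernel into Omega vanishes once all Ext^j(X, Omega), j > 1, do. Hence
    Ext^1(X, Omega) = m Ext^1(X, Omega), and Nakayama's lemma applies.

    Since R is complete, Omega is linearly compact, so a map into Omega that
    extends to every finitely generated piece extends globally (Zorn); thus
    Ext^1(M, Omega) = 0 for M in lim CM, which is injectivity.

    For duality, let F be finitely generated with a map to M^*, and let
    0 -> K -> P -> M -> 0 be a free presentation, so that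
    0 -> M^* -> P^* -> K^* -> 0 is exact. The map F -> P^* factors through
    Omega^n, which induces a map F' -> K^* from the cokernel F' of F -> Omega^n.
    By induction it factors through some Y' of depth at least e; the kernel of a
    surjection Omega^n + R^t -> Y' then has depth at least e + 1 (up to d), and
    F -> M^* factors through it. After d steps the module is in CM. *)

Require Import Defs.
From HB Require Import structures.
From mathcomp Require Import all_boot all_algebra.
From mathcomp Require Import finmap boolp ring.
From mathcomp Require classical_sets.
From mathcomp.multinomials Require Import monalg.

Set Implicit Arguments.
Unset Strict Implicit.
Unset Printing Implicit Defensive.

Import GRing.Theory.
Local Open Scope ring_scope.

(** Under Hom(-, Omega) a direct limit becomes an inverse limit, so duality on CM does not pass to
    lim CM formally. Lenzing's criterion avoids the inverse limit: only maps from finitely generated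
    F to M^* have to be factored, and such a map amounts to a map from M to the finitely generated
    module Hom(F, Omega). The syzygy K of M need not be finitely generated, but it satisfies the
    criterion again, which is why the induction ranges over all modules satisfying it.

    The textbook proof that Ext(X, Omega) vanishes cuts X down by an X-regular element of m, whose
    existence rests on prime avoidance. The tuple of all generators of m takes its place: X -> X^n
    is injective as soon as Hom(k, X) = 0. The price is that the cokernel is no longer X/xX, and its
    Ext into Omega has to be reached through a resolution of k and the remaining vanishing Ext^j(k,
    X). *)

Section Linear.
Variable R : comNzRingType.
Implicit Types U V W A B D K : lmodType R.

(** * Linear maps from relations; kernels, cokernels and pullbacks *)

Definition lin_of U V (f : U -> V) (fL : linear f) : {linear U -> V} :=
  HB.pack f (GRing.isLinear.Build R U V *:%R f fL).
Arguments lin_of U V f fL /.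

(** Linearity of the chosen [f] is automatic: 0 is related to the defect of linearity, which is
    therefore 0. Maps below are given by their graphs in this way, without a check on
    representatives. *)
Lemma exists_linear U V (rel : U -> V -> Prop) :
    (forall u, exists v, rel u v) ->
    (forall v, rel 0 v -> v = 0) ->
    (forall a u u' v v', rel u v -> rel u' v' -> rel (a *: u + u') (a *: v + v')) ->
  exists f : {linear U -> V}, forall u, rel u (f u).
Proof.
move=> tot fun0 clos; have [f fP] := choice tot.
suff fL : linear f by exists (lin_of fL).
move=> a u u'; apply/eqP; rewrite -subr_eq0; apply/eqP/fun0.
have := clos (-1) _ _ _ _ (clos a _ _ _ _ (fP u) (fP u')) (fP (a *: u + u')).
by rewrite !scaleN1r addNr [X in rel _ X]addrC.
Qed.

Lemma factor_surj A B U (g : {linear A -> B}) (f : {linear A -> U}) :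
    (forall b, exists a, g a = b) -> (forall a, g a = 0 -> f a = 0) ->
  exists h : {linear B -> U}, forall a, h (g a) = f a.
Proof.
move=> gS gf.
have [|v [a [ga0 <-]]||h hP] :=
  @exists_linear B U (fun b u => exists a, g a = b /\ f a = u).
- by move=> b; have [a <-] := gS b; exists (f a), a.
- exact: gf.
- move=> r u u' v v' [a [<- <-]] [a' [<- <-]].
  by exists (r *: a + a'); rewrite !linearP.
exists h => a; have [a' [ga' <-]] := hP (g a).
by apply/eqP; rewrite -subr_eq0 -linearB gf ?linearB ?ga' ?subrr.
Qed.

Lemma factor_inj A B U (i : {linear A -> B}) (f : {linear U -> B}) :
    injective i -> (forall u, exists a, i a = f u) ->
  exists h : {linear U -> A}, forall u, i (h u) = f u.
Proof.
move=> iI fi.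
have [|||h hP] := @exists_linear U A (fun u a => i a = f u).
- exact: fi.
- by move=> a ia; apply: iI; rewrite ia !linear0.
- by move=> r u u' a a' ia ia'; rewrite !linearP ia ia'.
- by exists h.
Qed.

Lemma linear_inj0 U V (f : {linear U -> V}) :
  (forall u, f u = 0 -> u = 0) -> injective f.
Proof.
move=> f0 u v fuv; apply/eqP; rewrite -subr_eq0; apply/eqP/f0.
by rewrite linearB fuv subrr.
Qed.

Lemma exists_submodule U (P : U -> Prop) : P 0 ->
    (forall a u v, P u -> P v -> P (a *: u + v)) ->
  exists (K : lmodType R) (i : {linear K -> U}),
    injective i /\ (forall u, P u <-> exists k, i k = u).
Proof.
move=> P0 PP.
have Pc : submod_closed [pred u : U | `[< P u >]].
  split=> [|a u v]; rewrite !inE; first exact/asboolP.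
  by move=> /asboolP Pu /asboolP Pv; apply/asboolP/PP.
exists (submod (Submodule Pc)), (@submod_val R U (Submodule Pc)).
split=> [|u]; first exact: val_inj.
split=> [Pu|[k <-]]; last by apply/asboolP; have := submod_valP k; rewrite inE.
have uP : u \in (Submodule Pc : {pred U}) by rewrite inE; apply/asboolP.
by exists (Submod uP).
Qed.

Lemma exists_ker U V (f : {linear U -> V}) :
  exists (K : lmodType R) (i : {linear K -> U}),
    injective i /\ (forall u, f u = 0 <-> exists k, i k = u).
Proof.
apply: exists_submodule => [|a u v fu fv]; first by rewrite linear0.
by rewrite linearP fu fv scaler0 addr0.
Qed.

Lemma quotmod_pi_eq0 U (S : submodule U) u :
  quotmod_pi S u = 0 <-> u \in (S : {pred U}).
Proof.
rewrite -[u in X in _ <-> X]subr0 Quotient.idealrBE.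
have -> : \pi_(Quotient.quot ((S : {pred U}) : zmodClosed U))%qT 0 = 0 :> quotmod S.
  exact: raddf0.
by rewrite -(rwP eqP).
Qed.

Lemma quotmod_pi_linear U (S : submodule U) : linear (quotmod_pi S).
Proof. by move=> a u v; rewrite quotmod_piD -quotmod_piZ. Qed.

Lemma exists_quotient U (P : U -> Prop) : P 0 ->
    (forall a u v, P u -> P v -> P (a *: u + v)) ->
  exists (Q : lmodType R) (p : {linear U -> Q}),
    (forall q, exists u, p u = q) /\ (forall u, p u = 0 <-> P u).
Proof.
move=> P0 PP.
have Pc : submod_closed [pred u : U | `[< P u >]].
  split=> [|a u v]; rewrite !inE; first exact/asboolP.
  by move=> /asboolP Pu /asboolP Pv; apply/asboolP/PP.
exists (quotmod (Submodule Pc)), (lin_of (@quotmod_pi_linear _ (Submodule Pc))).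
split=> [q|u]; first by have [u ->] := quotmod_piP q; exists u.
have E := quotmod_pi_eq0 (Submodule Pc) u; rewrite inE in E.
by split=> [/E /asboolP|Pu]; [|apply/E/asboolP].
Qed.

Lemma exists_coker U V (f : {linear U -> V}) :
  exists (Q : lmodType R) (p : {linear V -> Q}),
    (forall q, exists u, p u = q) /\ (forall v, p v = 0 <-> exists u, f u = v).
Proof.
apply: exists_quotient; first by exists 0; rewrite linear0.
by move=> a u v [x <-] [y <-]; exists (a *: x + y); rewrite linearP.
Qed.

(** A predicate on cones rather than a submodule of [A * B]: exchanging the two legs then costs
    nothing, as Schanuel's argument requires. *)
Record pullback A B U D (f : {linear A -> U}) (g : {linear B -> U})
    (p : {linear D -> A}) (q : {linear D -> B}) : Prop := Pullback {
  pullback_comm : forall d, f (p d) = g (q d);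
  pullback_ex : forall a b, f a = g b -> exists d, p d = a /\ q d = b;
  pullback_inj : forall d, p d = 0 -> q d = 0 -> d = 0
}.

Lemma pullback_sym A B U D (f : {linear A -> U}) (g : {linear B -> U})
    (p : {linear D -> A}) (q : {linear D -> B}) : pullback f g p q -> pullback g f q p.
Proof.
move=> [c e i]; split=> [d|b a fg|d q0 p0]; first by rewrite c.
  by have [d [pd qd]] := e _ _ (esym fg); exists d.
exact: i.
Qed.

Lemma exists_pullback A B U (f : {linear A -> U}) (g : {linear B -> U}) :
  exists (D : lmodType R) (p : {linear D -> A}) (q : {linear D -> B}), pullback f g p q.
Proof.
have [||D [i [iI iP]]] := @exists_submodule (A * B)%type (fun z => f z.1 = g z.2).
- by rewrite !linear0.
- by move=> a u v /= Hu Hv; rewrite !linearP Hu Hv.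
exists D, (fst \o i : {linear D -> A}), (snd \o i : {linear D -> B}); split=> /=.
- by move=> d; apply/iP; exists d.
- by move=> a b fg; have [|d id] := (iP (a, b)).1 => //; exists d; rewrite id.
move=> d p0 q0; apply: iI; rewrite linear0 [i d]surjective_pairing p0 q0.
by [].
Qed.

(** The fibre of [q] over [b] is the fibre of [f] over [g b], so the kernel does not change: an
    extension of [U] by [K] pulls back to one of [B] by [K]. *)
Lemma se_pullback K A B U D (k : {linear K -> A}) (f : {linear A -> U})
    (g : {linear B -> U}) (p : {linear D -> A}) (q : {linear D -> B}) :
    short_exact k f -> pullback f g p q ->
  exists s : {linear K -> D}, short_exact s q /\ (forall x, p (s x) = k x).
Proof.
move=> [kI fE fS] [c e i].
have D0 d d' : p d = p d' -> q d = q d' -> d = d'.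
  by move=> pd qd; apply/eqP; rewrite -subr_eq0; apply/eqP/i; rewrite linearB (pd, qd) subrr.
have [|||s sP] := @exists_linear _ _ (fun x d => p d = k x /\ q d = 0).
- by move=> x; apply: e; rewrite linear0; apply/fE; exists x.
- by move=> d [pd qd]; apply: i; rewrite // pd linear0.
- move=> a x x' d d' [pd qd] [pd' qd'].
  by rewrite !linearP pd qd pd' qd' scaler0 addr0.
exists s; split=> [|x]; last by have [] := sP x.
split.
- by move=> x y sxy; apply: kI; rewrite -(proj1 (sP x)) -(proj1 (sP y)) sxy.
- move=> d; split=> [qd|[x <-]]; last by have [] := sP x.
  have [|x kx] := (fE (p d)).1; first by rewrite c qd linear0.
  by exists x; have [px qx] := sP x; apply: D0; rewrite ?px ?qx ?kx.
- by move=> b; have [a fa] := fS (g b); have [d [_ <-]] := e _ _ fa; exists d.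
Qed.

End Linear.

(** * Vanishing of Ext in terms of extension of homomorphisms *)

Section ExtVanishing.
Variable R : comNzRingType.
Implicit Types A B K L M N P Q U V X Y : lmodType R.

Definition surj A B (f : A -> B) := forall b, exists a, f a = b.

Definition projective P : Prop :=
  forall A B (g : {linear A -> B}) (u : {linear P -> B}), surj g ->
    exists v : {linear P -> A}, forall p, g (v p) = u p.

Definition ffun_ev (I : finType) V (i : I) : {linear {ffun I -> V} -> V} :=
  @lin_of R {ffun I -> V} V (fun x => x i)
    (fun a x y => etrans (ffunE _ _) (congr1 (fun z => z + y i) (ffunE _ _))).
Arguments ffun_ev I V i /.

Lemma ffun_lin_subproof (I : finType) U V (h : I -> {linear U -> V}) :
  linear (fun u => [ffun i => h i u]).
Proof. by move=> a u v; apply/ffunP => i; rewrite !ffunE linearP. Qed.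

Definition ffun_lin (I : finType) U V (h : I -> {linear U -> V}) :
    {linear U -> {ffun I -> V}} := lin_of (ffun_lin_subproof h).

Lemma ffun_linE (I : finType) U V (h : I -> {linear U -> V}) u i :
  ffun_lin h u i = h i u.
Proof. by rewrite /= ffunE. Qed.

Lemma se_ffun V n :
  exists (f : {linear V -> {ffun 'I_n.+1 -> V}})
         (g : {linear {ffun 'I_n.+1 -> V} -> {ffun 'I_n -> V}}),
    [/\ short_exact f g, forall v, f v ord0 = v & forall x i, g x i = x (lift ord0 i)].
Proof.
pose f := ffun_lin (fun i : 'I_n.+1 => if i == ord0 then (idfun : {linear V -> V}) else \0).
pose g := ffun_lin (fun i : 'I_n => ffun_ev V (lift ord0 i)).
exists f, g; split=> [|v|x i]; last 2 first.
- by rewrite ffun_linE eqxx.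
- by rewrite ffun_linE.
split.
- by move=> u v /(congr1 (fun x : {ffun 'I_n.+1 -> V} => x ord0)); rewrite !ffun_linE.
- move=> x; split=> [x0|[v <-]]; last first.
    by apply/ffunP => i; rewrite [LHS]ffun_linE [LHS]ffun_linE [RHS]ffunE.
  exists (x ord0); apply/ffunP => i; rewrite ffun_linE.
  have [j ->|->] := unliftP ord0 i; last by [].
  by move/ffunP: x0 => /(_ j); rewrite ffun_linE ffunE.
- move=> y; exists [ffun i => if unlift ord0 i is Some j then y j else 0].
  by apply/ffunP => i; rewrite ffun_linE /= ffunE liftK.
Qed.

(* ext_vanish M i N means Ext^(i+1)(N, M) = 0: the index is shifted by one. *)
Fixpoint ext_vanish M (i : nat) N : Prop :=
  if i is j.+1 then
    forall K P (f : {linear K -> P}) (g : {linear P -> N}),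
      projective P -> short_exact f g -> ext_vanish M j K
  else
    forall A B (f : {linear A -> B}) (g : {linear B -> N}), short_exact f g ->
      forall h : {linear A -> M}, exists h' : {linear B -> M},
        forall x, h' (f x) = h x.

Definition pair_lin U A B (f : {linear U -> A}) (g : {linear U -> B}) :
    {linear U -> (A * B)%type} :=
  @lin_of R U (A * B)%type (fun u => (f u, g u))
    (fun a u v => congr2 pair (linearP f a u v) (linearP g a u v)).

Definition copair_lin A B U (f : {linear A -> U}) (g : {linear B -> U}) :
    {linear (A * B)%type -> U} :=
  (f \o fst) \+ (g \o snd) : {linear (A * B)%type -> U}.

Definition inl_lin A B : {linear A -> (A * B)%type} := pair_lin idfun \0.
Definition inr_lin A B : {linear B -> (A * B)%type} := pair_lin \0 idfun.

Arguments pair_lin U A B f g /.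
Arguments copair_lin A B U f g /.
Arguments inl_lin A B /.
Arguments inr_lin A B /.

Lemma se0 A B N (f : {linear A -> B}) (g : {linear B -> N}) x :
  short_exact f g -> g (f x) = 0.
Proof. by move=> [_ E _]; apply/E; exists x. Qed.

(** One presentation controls all extensions: lifting [P -> N] through [B] exhibits
    [0 -> A -> B -> N -> 0] as the pushout of the presentation along [K -> A]. *)
Lemma ext_vanish0_presentation M K P N (f : {linear K -> P}) (g : {linear P -> N}) :
    projective P -> short_exact f g ->
    (forall h : {linear K -> M}, exists u : {linear P -> M}, forall x, u (f x) = h x) ->
  ext_vanish M 0 N.
Proof.
move=> prP fg ext A B a b ab h; have [_ fgE gS] := fg; have [aI abE bS] := ab.
have [t tE] := prP _ _ b g bS.
have [k|s sE] := @factor_inj _ A B K a (t \o f : {linear K -> B}) aI.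
  by apply/abE; rewrite /= tE (se0 _ fg).
have [u uE] := ext (h \o s : {linear K -> M}).
(* [B] is the sum of the images of [A] and [P], which overlap in [K]; [h] and [u] are glued along
   the overlap. *)
have [||| h' hP] := @exists_linear _ B M
  (fun y m => exists x p, y = a x + t p /\ m = h x + u p).
- move=> y; have [p gp] := gS (b y).
  have [|x ax] := (abE (y - t p)).1; first by rewrite linearB tE gp subrr.
  by exists (h x + u p), x, p; rewrite ax subrK.
- move=> m [x [p [E ->]]].
  have [|k kp] := (fgE p).1.
    rewrite -tE -[t p](addKr (a x)) -E addr0 linearN (se0 _ ab).
    exact: oppr0.
  have -> : x = - s k.
    by apply: aI; rewrite linearN sE /= kp; apply/eqP; rewrite -addr_eq0 -E.
  by rewrite -kp uE /= linearN addNr.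
- move=> r y y' m m' [x [p [-> ->]]] [x' [p' [-> ->]]].
  exists (r *: x + x'), (r *: p + p'); rewrite !linearP !scalerDr.
  by split; rewrite addrACA.
exists h' => x; have [x' [p [E ->]]] := hP (a x).
have [|k kp] := (fgE p).1.
  by rewrite -tE; rewrite -[t p](addKr (a x')) -E linearD linearN !(se0 _ ab) oppr0 addr0.
have -> : x = x' + s k by apply: aI; rewrite linearD sE /= kp.
by rewrite -kp uE linearD.
Qed.

Lemma ext_vanish_iso M i N N' (e : {linear N -> N'}) (e' : {linear N' -> N}) :
  cancel e e' -> cancel e' e -> ext_vanish M i N -> ext_vanish M i N'.
Proof.
move=> eK e'K.
have se_iso A B (f : {linear A -> B}) (g : {linear B -> N'}) :
    short_exact f g -> short_exact f (e' \o g : {linear B -> N}).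
  move=> [fI gE gS]; split=> //= [y|n].
    by rewrite -gE; split=> [/(congr1 e)|->]; rewrite ?e'K linear0.
  by have [y gy] := gS (e n); exists y; rewrite gy.
case: i => [|i] EN A B f g.
  by move=> /se_iso fg h; apply: EN fg h.
by move=> prB /se_iso fg; apply: EN prB fg.
Qed.

Lemma linear_sum_malg (K : choiceType) V (phi : K -> V) :
  linear (fun g : {malg R[K]} => \sum_(x <- msupp g) g@_x *: phi x).
Proof.
have E (D : {fset K}) (g : {malg R[K]}) : (msupp g `<=` D)%fset ->
    \sum_(x <- msupp g) g@_x *: phi x = \sum_(x <- D) g@_x *: phi x.
  move=> gD; apply: big_fset_incl => // x _ /mcoeff_outdom ->.
  by rewrite scale0r.
move=> a g h; pose D := (msupp g `|` msupp h)%fset.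
rewrite (E D g) ?fsubsetUl // (E D h) ?fsubsetUr // (E D (a *: g + h)).
  rewrite scaler_sumr -big_split /=; apply: eq_bigr => x _.
  by rewrite mcoeffD mcoeffZ scalerDl scalerA.
apply: fsubset_trans (msuppD_le _ _) _; apply: fsetSU; exact: msuppZ_le.
Qed.

Lemma malg_projective (K : choiceType) : projective {malg R[K]}.
Proof.
move=> A B g u gS; have [phi phiE] := choice (fun x : K => gS (u << x >>)).
exists (lin_of (linear_sum_malg phi)) => z /=; rewrite linear_sum.
rewrite [in RHS](monalgE z) linear_sum; apply: eq_bigr => x _.
rewrite linearZ /= phiE -linearZ; congr (u _).
by apply/malgP => y; rewrite mcoeffZ !mcoeffU mulr_natr.
Qed.

Lemma free_cover_surj N : surj (@free_cover R N).
Proof.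
move=> x; exists << x >>; rewrite (@free_coverE _ _ [fset x]%fset).
  by rewrite big_seq_fset1 mcoeffUU scale1r.
exact: msuppU_le.
Qed.

Lemma exists_projective N :
  exists (P : lmodType R) (p : {linear P -> N}), projective P /\ surj p.
Proof.
exists {malg R[N]}, (@free_cover R N); split; first exact: malg_projective.
exact: free_cover_surj.
Qed.

Lemma exists_presentation P N (p : {linear P -> N}) : surj p ->
  exists (K : lmodType R) (f : {linear K -> P}), short_exact f p.
Proof. by move=> pS; have [K [f [fI fE]]] := exists_ker p; exists K, f; split. Qed.

Lemma projective_pair P Q : projective P -> projective Q -> projective (P * Q)%type.
Proof.
move=> prP prQ A B g u gS.
have [v vE] := prP _ _ g (u \o inl_lin P Q : {linear P -> B}) gS.
have [w wE] := prQ _ _ g (u \o inr_lin P Q : {linear Q -> B}) gS.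
exists (copair_lin v w) => -[p q] /=.
rewrite linearD vE wE /= -linearD; congr (u _).
by congr pair; rewrite /= ?addr0 ?add0r.
Qed.

Lemma projective_ker K Q P (f : {linear K -> Q}) (g : {linear Q -> P}) :
  projective Q -> projective P -> short_exact f g -> projective K.
Proof.
move=> prQ prP [fI gE gS] A B g' u g'S.
have [s sE] := prP _ _ g idfun gS.
have [q|rho rhoE] := @factor_inj _ K Q Q f (idfun \- (s \o g) : {linear Q -> Q}) fI.
  by apply/gE; rewrite linearB /= sE subrr.
have [v vE] := prQ _ _ g' (u \o rho : {linear Q -> B}) g'S.
exists (v \o f : {linear K -> A}) => k /=; rewrite vE /=; congr (u _).
have gf0 : g (f k) = 0 by apply/gE; exists k.
by apply: fI; rewrite rhoE /= gf0 linear0 subr0.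
Qed.

Lemma ext_vanish_projective M i P : projective P -> ext_vanish M i P.
Proof.
elim: i P => [|i IH] P prP; last first.
  by move=> K Q f g prQ fg; apply/IH/(projective_ker prQ prP fg).
(* [P] presents itself with kernel 0, so the zero map extends every [h]. *)
have [|K [f fg]] := @exists_presentation P P idfun; first by move=> x; exists x.
apply: (ext_vanish0_presentation prP fg) => h.
exists (\0 : {linear P -> M}) => k; have [fI _ _] := fg.
by rewrite (fI k 0) ?linear0 //; exact: (se0 k fg).
Qed.

Lemma se_pair K P N Q (f : {linear K -> P}) (g : {linear P -> N}) : short_exact f g ->
  exists (f' : {linear K -> (P * Q)%type}) (g' : {linear (P * Q)%type -> (N * Q)%type}),
    short_exact f' g' /\ (forall k, f' k = (f k, 0)).
Proof.
move=> [fI gE gS].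
exists (pair_lin f \0), (pair_lin (g \o fst : {linear (P * Q)%type -> N}) snd).
split=> //; split=> /=.
- by move=> x y [] /fI.
- move=> [p q] /=; split=> [[/gE [k <-] ->]|[k [<- <-]]]; first by exists k.
  by congr pair; apply/gE; exists k.
- by move=> [n q]; have [p <-] := gS n; exists (p, q).
Qed.

Lemma ext_vanish_summand M i N Q :
  projective Q -> ext_vanish M i (N * Q)%type -> ext_vanish M i N.
Proof.
case: i => [|i] prQ E A B f g.
  move=> fg h; have [f' [g' [fg' f'E]]] := se_pair Q fg.
  have [h' h'E] := E _ _ _ _ fg' h.
  by exists (h' \o inl_lin B Q : {linear B -> M}) => x; rewrite -h'E f'E.
move=> prB fg; have [f' [g' [fg' _]]] := se_pair Q fg.
exact: E (projective_pair prB prQ) fg'.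
Qed.

(* Rotation: a projective cover P -> X'' with kernel K yields the exact
   sequence 0 -> K -> X' + P -> X -> 0. *)
Lemma ext_vanish_rotation M i X' X X'' (a : {linear X' -> X}) (b : {linear X -> X''}) :
    (forall (Y' Y Y'' : lmodType R) (f : {linear Y' -> Y}) (g : {linear Y -> Y''}),
       short_exact f g -> ext_vanish M i Y' -> ext_vanish M i Y'' -> ext_vanish M i Y) ->
    short_exact a b -> ext_vanish M i X -> ext_vanish M i.+1 X'' ->
  ext_vanish M i X'.
Proof.
move=> L1 ab EX EX''; have [aI bE bS] := ab.
have [P [p [prP pS]]] := exists_projective X''.
have [K [k kp]] := exists_presentation pS; have [kI pE _] := kp.
have [lam lamE] := prP _ _ b p bS.
have [x|kap kapE] := @factor_inj _ X' X K a (\- (lam \o k) : {linear K -> X}) aI.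
  by apply/bE; rewrite linearN /= lamE (se0 x kp) oppr0.
apply: (ext_vanish_summand prP).
apply: (L1 _ _ _ (pair_lin kap k) (copair_lin a lam)) => //; last exact: EX'' prP kp.
split=> /=.
- by move=> x y [] _ /kI.
- move=> [x q] /=; split=> [E|[y [<- <-]]]; last by rewrite kapE /= addNr.
  have [|y yq] := (pE q).1.
    by rewrite -lamE -[lam q](addKr (a x)) E addr0 linearN (se0 x ab) oppr0.
  exists y; congr pair => //; apply: aI; rewrite kapE /= yq.
  by apply/eqP; rewrite eq_sym -addr_eq0 E.
- move=> x; have [q pq] := pS (b x).
  have [|x' ax'] := (bE (x - lam q)).1; first by rewrite linearB lamE pq subrr.
  by exists (x', q); rewrite /= ax' subrK.
Qed.

(** [L] is the preimage of [X'] in [B]; it cuts the extension of [X] by [A] into one of [X'] by [A]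
    and one of [X''] by [L]. *)
Lemma se_preimage A B X' X X'' (f : {linear A -> B}) (g : {linear B -> X})
    (a : {linear X' -> X}) (b : {linear X -> X''}) :
    short_exact f g -> short_exact a b ->
  exists L (l : {linear L -> B}) (phi : {linear A -> L}) (psi : {linear L -> X'}),
    [/\ short_exact l (b \o g : {linear B -> X''}), short_exact phi psi,
        forall x, l (phi x) = f x & forall x, a (psi x) = g (l x)].
Proof.
move=> fg ab; have [fI gE gS] := fg; have [aI bE bS] := ab.
have [|L [l lbg]] := @exists_presentation B X'' (b \o g : {linear B -> X''}).
  by move=> z; have [x <-] := bS z; have [y <-] := gS x; exists y.
have [lI lE _] := lbg.
have [x|phi phiE] := @factor_inj _ L B A l f lI.
  by apply/lE => /=; rewrite (se0 x fg) linear0.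
have [x|psi psiE] := @factor_inj _ X' X L a (g \o l : {linear L -> X}) aI.
  by apply/bE; exact: (se0 x lbg).
exists L, l, phi, psi; split=> //; split.
- by move=> x y /(congr1 l); rewrite !phiE => /fI.
- move=> y; split=> [E|[x <-]]; last first.
    by apply: aI; rewrite psiE /= phiE (se0 x fg) linear0.
  have [|x fx] := (gE (l y)).1; first by rewrite -[g (l y)]psiE E linear0.
  by exists x; apply: lI; rewrite phiE.
- move=> z; have [y gy] := gS (a z).
  have [|w lw] := (lE y).1; first by rewrite /= gy (se0 z ab).
  by exists w; apply: aI; rewrite psiE /= lw.
Qed.

(** In degree index 0 a map on [A] is extended first to the preimage of [X'], then to [B]. In higher
    degrees rotation is applied to that preimage, and it needs the present statement one degree
    lower; this is why [ext_vanish_rotation] takes it as a hypothesis. *)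
Lemma ext_vanish_extension M i X' X X'' (a : {linear X' -> X}) (b : {linear X -> X''}) :
    short_exact a b -> ext_vanish M i X' -> ext_vanish M i X'' ->
  ext_vanish M i X.
Proof.
elim: i X' X X'' a b => [|i IH] X' X X'' a b ab EX' EX'' A B f g.
  move=> fg h; have [L [l [phi [psi [lbg pp lphi _]]]]] := se_preimage fg ab.
  have [h1 h1E] := EX' _ _ _ _ pp h; have [h2 h2E] := EX'' _ _ _ _ lbg h1.
  by exists h2 => x; rewrite -lphi h2E h1E.
move=> prB fg; have [L [l [phi [psi [lbg pp _ _]]]]] := se_preimage fg ab.
apply: (ext_vanish_rotation _ pp) EX'; last exact: EX'' prB lbg.
exact: IH.
Qed.

Lemma ext_vanish_sub M i X' X X'' (a : {linear X' -> X}) (b : {linear X -> X''}) :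
    short_exact a b -> ext_vanish M i X -> ext_vanish M i.+1 X'' ->
  ext_vanish M i X'.
Proof.
by apply: ext_vanish_rotation => Y' Y Y'' f g; apply: ext_vanish_extension.
Qed.

(** [ext_vanish] quantifies over all presentations, and Schanuel's argument reduces this to one: the
    fibre product [D] of two presentations is an extension of [P'] by [K] and of [P] by [K']. *)
Lemma ext_vanishS M i K P N (f : {linear K -> P}) (g : {linear P -> N}) :
  projective P -> short_exact f g -> ext_vanish M i K -> ext_vanish M i.+1 N.
Proof.
move=> prP fg EK K' P' f' g' prP' fg'.
have [D [p [q D_pb]]] := exists_pullback g g'.
have [s [sq _]] := se_pullback fg D_pb.
have [s' [s'p _]] := se_pullback fg' (pullback_sym D_pb).
apply: ext_vanish_sub s'p _ (ext_vanish_projective _ _ prP).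
exact: ext_vanish_extension sq EK (ext_vanish_projective _ _ prP').
Qed.

Lemma ext_vanish_ffun M i n X :
  ext_vanish M i X -> ext_vanish M i {ffun 'I_n -> X}.
Proof.
move=> EX; elim: n => [|n IH].
  apply: ext_vanish_projective => A B g u _; exists \0 => p /=.
  by have -> : p = 0 by [apply/ffunP => -[]]; rewrite !linear0.
have [f [g [fg _ _]]] := se_ffun X n.
exact: ext_vanish_extension fg EX IH.
Qed.

Lemma ext_vanish_ffun_target M i n N :
  ext_vanish M i N -> ext_vanish {ffun 'I_n -> M} i N.
Proof.
elim: i N => [|i IH] N EN A B f g.
  move=> fg h.
  have [u uE] := choice (fun j => EN _ _ _ _ fg (ffun_ev M j \o h : {linear A -> M})).
  by exists (ffun_lin u) => x; apply/ffunP => j; rewrite ffun_linE uE.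
by move=> prB fg; apply/IH/(EN _ _ _ _ prB fg).
Qed.

Lemma ext_vanish_pair_target M M' i N :
  ext_vanish M i N -> ext_vanish M' i N -> ext_vanish (M * M')%type i N.
Proof.
elim: i N => [|i IH] N EN EN' A B f g.
  move=> fg h.
  have [u uE] := EN _ _ _ _ fg (fst \o h : {linear A -> M}).
  have [v vE] := EN' _ _ _ _ fg (snd \o h : {linear A -> M'}).
  by exists (pair_lin u v) => x /=; rewrite uE vE /= -surjective_pairing.
by move=> prB fg; apply: IH; [apply: EN prB fg | apply: EN' prB fg].
Qed.

(** This is exactness of Hom(N, M) -> Hom(N, M'') -> Ext^1(N, M') -> Ext^1(N, M): [h] is extended
    with values in [M], and subtracting a lift of the induced map [N -> M''] moves the extension
    into [M']. *)
Lemma ext_vanish0_covariant M' M M'' N (a : {linear M' -> M}) (b : {linear M -> M''}) :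
    short_exact a b -> ext_vanish M 0 N ->
    (forall h : {linear N -> M''}, exists h' : {linear N -> M}, forall x, b (h' x) = h x) ->
  ext_vanish M' 0 N.
Proof.
move=> [aI bE bS] EN lift A B f g fg h; have [_ gE gS] := fg.
have [u uE] := EN _ _ _ _ fg (a \o h : {linear A -> M}).
have [y /gE [x <-]|v vE] := @factor_surj _ B N M'' g (b \o u : {linear B -> M''}) gS.
  by rewrite /= uE; apply/bE; exists (h x).
have [v' v'E] := lift v.
have [y|w wE] := @factor_inj _ M' M B a (u \- (v' \o g) : {linear B -> M}) aI.
  by apply/bE; rewrite linearB /= v'E vE subrr.
exists w => x; apply: aI; rewrite wE /= uE (se0 x fg) linear0 subr0.
by [].
Qed.

Lemma ext_vanish_covariant M' M M'' i N (a : {linear M' -> M}) (b : {linear M -> M''}) :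
    short_exact a b -> ext_vanish M i.+1 N -> ext_vanish M'' i N ->
  ext_vanish M' i.+1 N.
Proof.
move=> ab; elim: i N => [|i IH] N EN EN'' K P f g prP fg; last first.
  by apply: IH; [apply: EN prP fg | apply: EN'' prP fg].
apply: (ext_vanish0_covariant ab); first exact: EN prP fg.
move=> h; have [u uE] := EN'' _ _ _ _ fg h; have [_ _ bS] := ab.
have [v vE] := prP _ _ b u bS.
by exists (v \o f : {linear K -> M}) => x; rewrite /= vE uE.
Qed.

End ExtVanishing.

(** * Comparison with the functorial Ext, Noetherian modules *)

Section ExtDef.
Variable R : comNzRingType.
Implicit Types M N : lmodType R.

Lemma free_res_se N i :
  short_exact (@submod_val R (free_res N i) (ker_submodule (@free_cover R (syzygy N i))))
              (@free_cover R (syzygy N i)).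
Proof.
split; [exact: val_inj | move=> y | exact: free_cover_surj].
split=> [y0|[k <-]]; last by have := submod_valP k; rewrite inE => /eqP.
have yP : y \in (ker_submodule (@free_cover R (syzygy N i)) : {pred _}).
  by rewrite inE y0.
by exists (Submod yP).
Qed.

Lemma Ext_eq0P N M i : (forall x : Ext N M i, x = 0) <->
  (forall f : cochain N M i, codiff f = 0 -> is_coboundary f).
Proof.
split=> [E0 f df|H x].
  have fc : f \in (cocycle N M i : {pred _}) by rewrite inE; apply/eqP.
  have := E0 (quotmod_pi _ (Submod fc)).
  by move/quotmod_pi_eq0; rewrite inE => /asboolP.
have [c ->] := quotmod_piP x; apply/quotmod_pi_eq0; rewrite inE; apply/asboolP.
by apply: H; have := submod_valP c; rewrite inE => /eqP.
Qed.

Lemma homR0_eq (U V : lmodType R) (f : homR U V) : f = 0 <-> forall x, f x = 0.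
Proof. by split=> [-> //|f0]; apply: homR_eq => x; rewrite f0. Qed.

(** The term of degree i+1 covers the kernel of [free_cover] in degree i, so a cocycle is a map that
    kills this kernel. *)
Lemma codiff_eq0P N M i (f : cochain N M i) :
  codiff f = 0 <-> exists h : {linear syzygy N i -> M}, forall x, f x = h (free_cover x).
Proof.
have [_ E _] := free_res_se N i; rewrite homR0_eq; split=> [f0|[h hE] x]; last first.
  rewrite /codiff /= hE (_ : free_cover _ = 0) ?linear0 //.
  by apply/E; exists (free_cover x).
have [a /E [b <-]|h hE] := factor_surj (f := f) (@free_cover_surj R (syzygy N i)).
  have [x <-] := free_cover_surj b.
  by have := f0 x; rewrite /codiff /=.
by exists h => x; rewrite hE.
Qed.

Lemma Ext0_eq0 N M : (forall x : Ext N M 0, x = 0) <->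
  (forall (h : {linear N -> M}) x, h x = 0).
Proof.
rewrite Ext_eq0P; split=> [H h x|H f /codiff_eq0P [h hE]].
  pose f : cochain N M 0 := h \o @free_cover R N : free_res N 0 -> M.
  have /H /= /homR0_eq f0 : codiff f = 0 by apply/codiff_eq0P; exists h.
  by have [y <-] := free_cover_surj x; rewrite -[RHS](f0 y).
by apply/homR0_eq => x; rewrite hE H.
Qed.

Lemma ext_vanish_syzygy M N i : ext_vanish M i N <-> ext_vanish M 0 (syzygy N i).
Proof.
suff H j : ext_vanish M (i + j) N <-> ext_vanish M j (syzygy N i) by rewrite -H addn0.
elim: i j => [//|i IH] j; rewrite addSnnS IH; split=> [E|].
  exact: E (@malg_projective R _) (free_res_se N i).
exact: ext_vanishS (@malg_projective R _) (free_res_se N i).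
Qed.

(** The bridge from the functorial [Ext] to extension of homomorphisms; the shift of the index by
    one enters here. *)
Lemma ExtS_eq0 N M i : (forall x : Ext N M i.+1, x = 0) <-> ext_vanish M i N.
Proof.
rewrite ext_vanish_syzygy Ext_eq0P; split=> [H|H f /codiff_eq0P [h hE]].
  apply: ext_vanish0_presentation (@malg_projective R _) (free_res_se N i) _ => h.
  pose f : cochain N M i.+1 := h \o @free_cover R (syzygy N i.+1) : free_res N i.+1 -> M.
  have /H /= [g gE] : codiff f = 0 by apply/codiff_eq0P; exists h.
  exists g => x; have [y <-] := free_cover_surj x.
  by have := congr1 (fun u : homR _ _ => u y) gE.
have [g gE] := H _ _ _ _ (free_res_se N i) h.
by exists g; apply: homR_eq => x; rewrite hE -gE.
Qed.
End ExtDef.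

(** * Finite generation and Noetherian induction *)

Section Noetherian.
Variable R : comNzRingType.
Implicit Types A B C K M N P Q V : lmodType R.

(** The unit ideal is allowed, unlike in [idealr], so that sums and colon ideals need no check of
    properness. *)
Definition is_ideal (I : R -> Prop) : Prop :=
  I 0 /\ forall a u v, I u -> I v -> I (a * u + v).

Definition free (n : nat) : lmodType R := {ffun 'I_n -> R^o}.

Lemma lincomb_subproof N n (g : 'I_n -> N) :
  linear (fun r : free n => \sum_i (r i : R) *: g i).
Proof.
move=> a x y; rewrite scaler_sumr -big_split /=; apply: eq_bigr => i _.
by rewrite !ffunE scalerDl scalerA.
Qed.

Definition lincomb N n (g : 'I_n -> N) : {linear free n -> N} :=
  lin_of (lincomb_subproof g).

Definition unit_vec n (i : 'I_n) : free n := [ffun j => (j == i)%:R].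

Lemma lincomb_unit_vec N n (g : 'I_n -> N) i : lincomb g (unit_vec i) = g i.
Proof.
rewrite /= (bigD1 i) //= big1 => [|j ji]; rewrite ffunE ?eqxx ?scale1r ?addr0 //.
by rewrite (negPf ji) scale0r.
Qed.

Lemma lincomb_linear N n (u : {linear free n -> N}) r :
  u r = lincomb (u \o @unit_vec n) r.
Proof.
have {1}-> : r = lincomb (@unit_vec n) r.
  apply/ffunP => j; rewrite /= sum_ffunE (bigD1 j) //= big1 => [|i ij].
    by rewrite !ffunE eqxx addr0; exact/esym/mulr1.
  by rewrite !ffunE eq_sym (negPf ij); exact: mulr0.
by rewrite /= linear_sum; apply: eq_bigr => i _; rewrite linearZ.
Qed.

Lemma linear_eq_generators N V n (p : {linear free n -> N}) (f g : {linear N -> V}) :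
    surj p -> (forall i, f (p (unit_vec i)) = g (p (unit_vec i))) ->
  forall x, f x = g x.
Proof.
move=> pS fg x; have [r <-] := pS x.
have := lincomb_linear (f \o p : {linear free n -> V}) r.
have := lincomb_linear (g \o p : {linear free n -> V}) r.
move=> /= -> ->; apply: eq_bigr => i _.
by rewrite fg.
Qed.

Lemma free_projective n : projective (free n).
Proof.
move=> A B g u gS; have [a aE] := choice (fun i => gS (u (unit_vec i))).
exists (lincomb a) => r; rewrite [RHS]lincomb_linear /= linear_sum.
by apply: eq_bigr => i _; rewrite linearZ aE.
Qed.

Lemma fin_genP N : fin_gen N <-> exists n (p : {linear free n -> N}), surj p.
Proof.
split=> [[n [g gP]]|[n [p pS]]].
  exists n, (lincomb g) => x; have [r ->] := gP x; exists [ffun i => r i].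
  by apply: eq_bigr => i _; rewrite ffunE.
exists n, (p \o @unit_vec n) => x; have [r <-] := pS x; exists r.
exact: lincomb_linear.
Qed.

Lemma fin_gen_free n : fin_gen (free n).
Proof. by apply/fin_genP; exists n, idfun => x; exists x. Qed.

Lemma fin_gen_surj A B (f : {linear A -> B}) : fin_gen A -> surj f -> fin_gen B.
Proof.
move=> /fin_genP [n [p pS]] fS; apply/fin_genP; exists n, (f \o p : {linear free n -> B}).
by move=> b; have [a <-] := fS b; have [r <-] := pS a; exists r.
Qed.

Lemma fin_gen_extension A B C (f : {linear A -> B}) (g : {linear B -> C}) :
    (forall b, g b = 0 -> exists a, f a = b) -> surj g ->
  fin_gen A -> fin_gen C -> fin_gen B.
Proof.
move=> gE gS [n [a aP]] [k [c cP]].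
have [b bP] := choice (fun i => gS (c i)).
exists (n + k)%N, (fun i => match split i with inl j => f (a j) | inr j => b j end).
move=> x; have [s sE] := cP (g x).
have [|y yE] := gE (x - \sum_i s i *: b i).
  apply/eqP; rewrite linearB linear_sum sE subr_eq0; apply/eqP/eq_bigr => i _.
  by rewrite linearZ bP.
have [r rE] := aP y.
exists (fun i => match split i with inl j => r j | inr j => s j end).
rewrite big_split_ord /= -[x](subrK (\sum_i s i *: b i)) -yE rE linear_sum.
congr (_ + _); apply: eq_bigr => i _.
  by rewrite (unsplitK (inl i)) linearZ.
by rewrite (unsplitK (inr i)).
Qed.

Lemma fin_gen_se A B C (f : {linear A -> B}) (g : {linear B -> C}) :
  short_exact f g -> fin_gen A -> fin_gen C -> fin_gen B.
Proof. by move=> [_ E S]; exact: fin_gen_extension (fun b => (E b).1) S. Qed.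

Lemma fin_gen_pair A B : fin_gen A -> fin_gen B -> fin_gen (A * B)%type.
Proof.
apply: (@fin_gen_extension _ _ _ (inl_lin A B) snd) => [[a b] /= ->|b].
  by exists a.
by exists (0, b).
Qed.

Lemma fin_gen_ffun n A : fin_gen A -> fin_gen {ffun 'I_n -> A}.
Proof.
move=> fgA; elim: n => [|n IH].
  exists 0%N, (fun=> 0) => x; exists (fun=> 0); rewrite big_ord0.
  by apply/ffunP => -[].
by have [f [g [fg _ _]]] := se_ffun A n; apply: fin_gen_se fg fgA IH.
Qed.

Definition noetherian_mod N : Prop :=
  forall K (i : {linear K -> N}), injective i -> fin_gen K.

(** A submodule [K] of [B] is cut into its intersection [L] with [A] and its image [Q] in [C]. *)
Lemma noetherian_mod_se A B C (f : {linear A -> B}) (g : {linear B -> C}) :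
  short_exact f g -> noetherian_mod A -> noetherian_mod C -> noetherian_mod B.
Proof.
move=> fg nA nC K i iI; have [fI gE gS] := fg.
have [L [l [lI lE]]] := exists_ker (g \o i : {linear K -> C}).
have [Q [q [qS qE]]] := exists_coker l.
have [x|u uE] := @factor_inj _ A B L f (i \o l : {linear L -> B}) fI.
  by apply/gE; apply/lE; exists x.
have [x|v vE] := @factor_surj _ K Q C q (g \o i : {linear K -> C}) qS.
  by move/qE => [y <-]; apply/lE; exists y.
apply: (@fin_gen_extension L K Q l q) => // [b /qE //||].
  by apply: (nA _ u) => x y /(congr1 f); rewrite !uE => /iI /lI.
apply: (nC _ v); apply: linear_inj0 => x; have [y <-] := qS x.
by rewrite vE => /lE [z <-]; apply/qE; exists z.
Qed.

Hypothesis noethR : noetherian R.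

Lemma noetherian_regular : noetherian_mod R^o.
Proof.
move=> K i iI.
have Pc : submod_closed [pred u : R^o | `[< exists k, i k = u >]].
  split=> [|a u v]; rewrite !inE; first by apply/asboolP; exists 0; rewrite linear0.
  move=> /asboolP [x <-] /asboolP [y <-]; apply/asboolP.
  by exists (a *: x + y); rewrite linearP.
have [||h hE] := @factor_inj _ K R^o (submod (Submodule Pc)) i
  (@submod_val R R^o (Submodule Pc)).
- exact: iI.
- by move=> u; have := submod_valP u; rewrite inE => /asboolP.
apply: (@fin_gen_surj _ _ h) (noethR (Submodule Pc)) _ => k.
have kP : i k \in (Submodule Pc : {pred R^o}) by rewrite inE; apply/asboolP; exists k.
by exists (Submod kP); apply: iI; rewrite hE.
Qed.

Lemma noetherian_free n : noetherian_mod (free n).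
Proof.
elim: n => [|n IH]; last first.
  by have [f [g [fg _ _]]] := se_ffun R^o n; apply: noetherian_mod_se fg noetherian_regular IH.
move=> K i iI; exists 0%N, (fun=> 0) => x; exists (fun=> 0); rewrite big_ord0.
by apply: iI; apply/ffunP => -[].
Qed.

Lemma fin_gen_sub N K (i : {linear K -> N}) : fin_gen N -> injective i -> fin_gen K.
Proof.
move=> /fin_genP [n [p pS]] iI.
have [D [q [r D_pb]]] := exists_pullback p i.
apply: (@fin_gen_surj D K r) => [|k].
  apply: (@noetherian_free n _ q); apply: linear_inj0 => d qd.
  apply: (pullback_inj D_pb) => //; apply: iI.
  by rewrite -(pullback_comm D_pb) qd !linear0.
by have [x px] := pS (i k); have [d [_ <-]] := pullback_ex D_pb px; exists d.
Qed.

Lemma ideal_gen (I : R -> Prop) : is_ideal I ->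
  exists n (g : 'I_n -> R), (forall i, I (g i)) /\
    forall x, I x -> exists r : 'I_n -> R, x = \sum_i r i * g i.
Proof.
move=> [I0 IP]; have [K [i [iI iE]]] := @exists_submodule R R^o I I0 IP.
have [n [g gP]] := noetherian_regular iI.
exists n, (i \o g); split=> [j|x /iE [k <-]]; first by apply/iE; exists (g j).
by have [r ->] := gP k; exists r; rewrite linear_sum; apply: eq_bigr => j _; rewrite linearZ.
Qed.

Lemma ideal_sum (I : R -> Prop) n (r g : 'I_n -> R) :
  is_ideal I -> (forall i, I (g i)) -> I (\sum_i r i * g i).
Proof.
move=> [I0 IP] Ig; elim/big_ind: _ => // [x y Ix Iy|i _].
  by rewrite -[x]mul1r; apply: IP.
by rewrite -[_ * _]addr0; apply: IP.
Qed.

(** A failure of [Pr] would start a strictly increasing chain of ideals; the generators of its union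
    all lie in the stage [B], where the chain would have to stop. *)
Lemma ideal_noetherian_ind (Pr : (R -> Prop) -> Prop) :
    (forall I, is_ideal I ->
      (forall J, is_ideal J -> (forall x, I x -> J x) -> (exists x, J x /\ ~ I x) -> Pr J) ->
      Pr I) ->
  forall I, is_ideal I -> Pr I.
Proof.
move=> ind I0 I0i; apply: contrapT => nI0.
pose T := {I | is_ideal I /\ ~ Pr I}.
have step (I : T) : exists J : T, (forall x, sval I x -> sval J x) /\
    exists x, sval J x /\ ~ sval I x.
  case: I => I [Ii nI] /=; apply: contrapT => noJ; apply: nI; apply: ind => // J Ji IJ IJs.
  by apply: contrapT => nJ; apply: noJ; exists (exist _ J (conj Ji nJ)).
have [next nextP] := choice step.
pose c n := iter n next (exist _ I0 (conj I0i nI0) : T).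
have c_le n k x : sval (c n) x -> sval (c (n + k)%N) x.
  by move=> cx; elim: k => [|k IH]; rewrite ?addn0 ?addnS //; apply: (nextP _).1.
have c_ideal n : is_ideal (sval (c n)) by case: (c n) => J [].
have Ui : is_ideal (fun x => exists n, sval (c n) x).
  split=> [|a u v [n cu] [k cv]]; first by exists 0%N; have [] := c_ideal 0%N.
  exists (n + k)%N; apply: (c_ideal _).2; first exact: c_le.
  by rewrite addnC; apply: c_le.
have [n [g [gU gP]]] := ideal_gen Ui.
have [N NP] := choice gU.
pose B := \max_i N i.
have gB i : sval (c B) (g i).
  by rewrite -(subnKC (leq_bigmax i : (N i <= B)%N)); apply: c_le.
have [_ [x [cx ncx]]] := nextP (c B); apply: ncx.
have [|r ->] := gP x; first by exists B.+1.
exact: ideal_sum.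
Qed.
End Noetherian.

(** * Nakayama's lemma and finite injective dimension *)

Section Local.
Variables (R : comNzRingType) (m : idealr R).
Implicit Types A B C K L M N P Q X : lmodType R.
Hypotheses (noethR : noetherian R) (localR : local_ring m).

Lemma idealr_is_ideal (J : idealr R) : is_ideal (fun x => x \in J).
Proof. by split=> [|a u v Ju Jv]; [exact: idealr0 | rewrite rpredD // idealMr]. Qed.

Lemma exists_idealr (I : R -> Prop) : is_ideal I -> ~ I 1 ->
  exists J : idealr R, forall x, x \in J <-> I x.
Proof.
move=> [I0 IP] I1.
have Ic : idealr_closed (fun x => `[< I x >]).
  split=> [||a u v]; rewrite !unfold_in; first exact/asboolP.
    by apply/asboolP.
  by move=> /asboolP Iu /asboolP Iv; apply/asboolP/IP.
pose J : idealr R := HB.pack (fun x => `[< I x >]) (isIdealr.Build R _ Ic).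
by exists J => x; rewrite unfold_in /=; split=> /asboolP.
Qed.

(** Noetherian induction stands in for Zorn's lemma: a proper ideal is maximal, hence equal to [m],
    or strictly contained in a larger proper ideal. *)
Lemma local_proper (I : R -> Prop) : is_ideal I -> ~ I 1 -> forall x, I x -> x \in m.
Proof.
move: I; apply: (ideal_noetherian_ind noethR
  (Pr := fun I => ~ I 1 -> forall x, I x -> x \in m)) => I Ii IH I1 x Ix.
have [J JE] := exists_idealr Ii I1.
have [maxJ|nmaxJ] := pselect (maximal_ideal J).
  by rewrite -(localR.2 J maxJ); apply/JE.
apply: contrapT => nmx; apply: nmaxJ => J' JJ' y J'y; apply: contrapT => nJy.
apply: nmx; apply: (IH (fun x => x \in J') _ _ _ _ x) => [|z Iz|||].
- exact: idealr_is_ideal.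
- by apply: JJ'; apply/JE.
- by exists y; split=> // Iy; apply: nJy; apply/JE.
- by rewrite idealr1.
- by apply: JJ'; apply/JE.
Qed.

Lemma local_unit x : x \notin m -> exists y, x * y = 1.
Proof.
move=> /negP xm; apply: contrapT => nu; apply: xm.
apply: (@local_proper (fun z => exists y, x * y = z)); last by exists 1; rewrite mulr1.
  split=> [|a u v [y <-] [z <-]]; first by exists 0; rewrite mulr0.
  by exists (a * y + z); rewrite mulrDr mulrCA.
exact: nu.
Qed.

(** The hypothesis Q = mQ makes the first generator redundant: g_0 is a sum of c_j g_j with all c_j
    in m, and 1 - c_0 is a unit. *)
Lemma nakayama Q : fin_gen Q ->
    (forall q, exists n (a : 'I_n -> R) (v : 'I_n -> Q),
       (forall i, a i \in m) /\ q = \sum_i a i *: v i) ->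
  forall q : Q, q = 0.
Proof.
move=> [k [g gP]] mQ; elim: k g gP => [|k IH] g gP.
  by move=> q; have [r ->] := gP q; rewrite big_ord0.
have [n [a [v [ma g0E]]]] := mQ (g ord0).
have [r rE] := choice (fun i => gP (v i)).
pose c j := \sum_i a i * r i j.
have mc j : c j \in m by apply: rpred_sum => i _; rewrite mulrC idealMr.
have {}g0E : g ord0 = \sum_j c j *: g j.
  rewrite g0E; under eq_bigr do rewrite rE scaler_sumr.
  rewrite exchange_big /=; apply: eq_bigr => j _; rewrite scaler_suml.
  by apply: eq_bigr => i _; rewrite scalerA.
have [|y yE] := @local_unit (1 - c ord0).
  apply/negP => m1; have := idealr1 m.
  by rewrite -[X in X \in _](subrK (c ord0)) rpredD.
have {}g0E : g ord0 = \sum_(j < k) (y * c (lift ord0 j)) *: g (lift ord0 j).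
  rewrite -[LHS]scale1r -yE mulrC -scalerA scalerBl scale1r {1}g0E big_ord_recl.
  rewrite addrC addKr scaler_sumr; apply: eq_bigr => j _.
  by rewrite scalerA.
apply: (IH (g \o lift ord0)) => q; have [s ->] := gP q.
exists (fun j => s ord0 * (y * c (lift ord0 j)) + s (lift ord0 j)).
rewrite big_ord_recl {1}g0E scaler_sumr -big_split; apply: eq_bigr => j _ /=.
by rewrite scalerDl scalerA.
Qed.

Definition homR_ev A B (x : A) : {linear homR A B -> B} :=
  @lin_of R (homR A B) B (fun f => f x) (fun a f g => erefl).

Lemma homR_sumE A B n (c : 'I_n -> R) (f : 'I_n -> homR A B) x :
  (\sum_i c i *: f i) x = \sum_i c i *: f i x.
Proof.
have E := linear_sum (homR_ev B x); rewrite [LHS]E.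
by [].
Qed.

Lemma fin_gen_homR A B : fin_gen A -> fin_gen B -> fin_gen (homR A B).
Proof.
move=> /fin_genP [n [p pS]] fgB.
have resL : linear (fun f : homR A B => [ffun i => f (p (unit_vec R i))]).
  by move=> c f g; apply/ffunP => i; rewrite !ffunE.
apply: (fin_gen_sub noethR (i := lin_of resL)); first exact: fin_gen_ffun.
apply: linear_inj0 => f /= f0; apply: homR_eq => x; have [r <-] := pS x.
have -> : f (p r) = (f \o p : {linear free R n -> B}) r by [].
rewrite lincomb_linear /= big1 // => i _.
by move/ffunP: f0 => /(_ i); rewrite !ffunE => ->; rewrite scaler0.
Qed.

(** * Multiplication by a tuple of elements of m, and its mapping cone *)

Definition ffun_map n A B (f : {linear A -> B}) :
    {linear {ffun 'I_n -> A} -> {ffun 'I_n -> B}} :=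
  ffun_lin (fun i => f \o ffun_ev A i : {linear {ffun 'I_n -> A} -> B}).
Arguments ffun_map {n A B} f.

Lemma ffun_mapE n A B (f : {linear A -> B}) (x : {ffun 'I_n -> A}) i :
  ffun_map f x i = f (x i).
Proof. exact: ffun_linE. Qed.

Lemma ffun_map_surj n A B (f : {linear A -> B}) : surj f -> surj (ffun_map (n := n) f).
Proof.
move=> fS y; have [g gE] := choice (fun i => fS (y i)).
by exists [ffun i => g i]; apply/ffunP => i; rewrite ffun_mapE ffunE.
Qed.

Lemma se_ffun_map n A B C (f : {linear A -> B}) (g : {linear B -> C}) :
  short_exact f g -> short_exact (ffun_map (n := n) f) (ffun_map (n := n) g).
Proof.
move=> fg; have [fI gE gS] := fg; split; last exact: ffun_map_surj.
  apply: linear_inj0 => x fx; apply/ffunP => i; rewrite ffunE; apply: fI.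
  by rewrite -ffun_mapE fx ffunE linear0.
move=> y; split=> [gy|[x <-]]; last first.
  by apply/ffunP => i; rewrite !ffun_mapE ffunE (se0 _ fg).
have H i : exists x, f x = y i by apply/gE; rewrite -ffun_mapE gy ffunE.
have [x xE] := choice H; exists [ffun i => x i].
by apply/ffunP => i; rewrite ffun_mapE ffunE.
Qed.

(** For [b = 1] this is multiplication by one element, as used for cyclic modules; for a tuple
    generating m it is the map from X to Hom(Q, X) = X^b. *)
Definition scale_map b (a : 'I_b -> R) N : {linear N -> {ffun 'I_b -> N}} :=
  ffun_lin (fun i => a i \*: (idfun : {linear N -> N}) : {linear N -> N}).
Arguments scale_map {b} a {N}.

Lemma scale_mapE b (a : 'I_b -> R) N (x : N) i : scale_map a x i = a i *: x.
Proof. exact: ffun_linE. Qed.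

Lemma scale_map_natural b (a : 'I_b -> R) A B (f : {linear A -> B}) x :
  scale_map a (f x) = ffun_map f (scale_map a x).
Proof. by apply/ffunP => i; rewrite ffun_mapE !scale_mapE linearZ. Qed.

Lemma projective_ffun n P : projective P -> projective {ffun 'I_n -> P}.
Proof.
move=> prP; elim: n => [|n IH] A B g u gS.
  exists \0 => p /=; have -> : p = 0 by apply/ffunP => -[].
  by rewrite !linear0.
have [f [h [[fI hE hS] f0 hl]]] := se_ffun P n.
have [s sE] := IH _ _ h idfun hS.
have [v vE] := prP _ _ g (u \o f : {linear P -> B}) gS.
have [w wE] := IH _ _ g (u \o s : {linear {ffun 'I_n -> P} -> B}) gS.
have [x|r rE] := @factor_inj _ P _ _ f
  (idfun \- (s \o h) : {linear {ffun 'I_n.+1 -> P} -> {ffun 'I_n.+1 -> P}}) fI.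
  by apply/hE; rewrite linearB /= sE subrr.
exists ((v \o r) \+ (w \o h) : {linear {ffun 'I_n.+1 -> P} -> A}) => x /=.
by rewrite linearD vE wE /= rE /= -linearD subrK.
Qed.

(* For syzygies K of N and L of N^b/N, where N -> N^b is multiplication by a,
   the mapping cone gives 0 -> K -> K^b + P -> L -> 0. *)
Definition cone_map b (a : 'I_b -> R) K P (i : {linear K -> P}) :
    {linear K -> ({ffun 'I_b -> K} * P)%type} :=
  pair_lin (\- scale_map a : {linear K -> {ffun 'I_b -> K}}) i.

Lemma cone_mapE b (a : 'I_b -> R) K P (i : {linear K -> P}) k :
  cone_map a i k = (- scale_map a k, i k).
Proof. by []. Qed.

Definition cone b (a : 'I_b -> R) K P (i : {linear K -> P}) L : Prop :=
  exists g : {linear ({ffun 'I_b -> K} * P)%type -> L},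
    short_exact (cone_map a i) g.

(** Nakayama is applied to Hom(K, M) modulo restrictions from [P], that is, to Ext^1 of [P/K]. An
    extension [u] of [h] along [cone_map] writes [h] as a combination of maps [K -> M] with
    coefficients [- a j], plus a restriction from [P]. *)
Lemma cone_extend b (a : 'I_b -> R) K P (i : {linear K -> P}) L M :
    (forall j, a j \in m) -> cone a i L -> fin_gen (homR K M) -> ext_vanish M 0 L ->
  forall h : {linear K -> M}, exists u : {linear P -> M}, forall k, u (i k) = h k.
Proof.
move=> ma [g coneg] fgH EL.
have [||Q [q [qS qE]]] := @exists_quotient _ (homR K M)
  (fun h => exists u : {linear P -> M}, forall k, u (i k) = h k).
- by exists \0.
- move=> c h h' [u uE] [u' u'E]; exists ((c \*: u) \+ u') => k /=.
  by rewrite uE u'E.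
have Q0 : forall x : Q, x = 0.
  apply: nakayama => [|x]; first exact: fin_gen_surj q fgH qS.
  have [h <-] := qS x; have [u uE] := EL _ _ _ _ coneg h.
  exists b, (fun j => - a j).
  pose e j : {linear K -> {ffun 'I_b -> K}} :=
    ffun_lin (fun l => if l == j then (idfun : {linear K -> K}) else \0).
  pose v j : homR K M := u \o (inl_lin _ P \o e j).
  exists (fun j => q (v j)).
  split=> [j|]; first by rewrite rpredN.
  under eq_bigr do rewrite -linearZ.
  rewrite -linear_sum; apply/eqP; rewrite -subr_eq0 -linearB; apply/eqP/qE.
  exists (u \o inr_lin _ P) => k.
  have -> : (h - \sum_i (- a i) *: v i) k = h k - (\sum_i (- a i) *: v i) k by [].
  rewrite homR_sumE -uE.
  pose u1 : {linear {ffun 'I_b -> K} -> M} := u \o inl_lin _ P.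
  have -> : \sum_j (- a j) *: v j k = u1 (- scale_map a k).
    transitivity (u1 (\sum_j (- a j) *: e j k)).
      by rewrite linear_sum; apply: eq_bigr => j _; rewrite linearZ.
    congr (u1 _); apply/ffunP => l; rewrite sum_ffunE (bigD1 l) //= big1 => [|j jl].
      by rewrite !ffunE eqxx addr0 scaleNr.
    by rewrite !ffunE eq_sym (negPf jl) scaler0.
  rewrite /= -linearB; congr (u _); congr pair; rewrite /= ?subrr ?subr0 //.
move=> h; have [u uE] := (qE h).1 (Q0 _).
by exists u.
Qed.

(** Syzygies of a cone are cones: the kernel of [P2^b + P -> L] is the image of [c], and the kernel
    of [c] is [K2], embedded by [cone_map]. The sign in [c] is what makes [q] vanish on its
    image. *)
Lemma cone_step b (a : 'I_b -> R) K P (i : {linear K -> P}) L K2 P2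
    (i2 : {linear K2 -> P2}) (p : {linear P2 -> K}) :
    short_exact i2 p -> cone a i L ->
  exists L2 (l : {linear L2 -> ({ffun 'I_b -> P2} * P)%type})
    (q : {linear ({ffun 'I_b -> P2} * P)%type -> L}),
    short_exact l q /\ cone a i2 L2.
Proof.
move=> ip [g [gI gE gS]]; have [i2I pE pS] := ip.
pose q : {linear ({ffun 'I_b -> P2} * P)%type -> L} :=
  g \o copair_lin (inl_lin _ P \o ffun_map p) (inr_lin _ P).
have qE z : q z = g (ffun_map p z.1, z.2).
  by congr (g _); congr pair; rewrite /= ?addr0 ?add0r.
have [|L2 [l lq]] := @exists_presentation _ _ _ q.
  move=> x; have [[k y] <-] := gS x; have [z pz] := ffun_map_surj pS k.
  by exists (z, y); rewrite qE pz.
exists L2, l, q; split=> //; have [lI lE _] := lq.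
have bE := se_ffun_map b ip.
pose c : {linear ({ffun 'I_b -> K2} * P2)%type -> ({ffun 'I_b -> P2} * P)%type} :=
  copair_lin (inl_lin _ P \o ffun_map i2)
             (pair_lin (scale_map a) (\- (i \o p) : {linear P2 -> P})).
have cE z : c z = (ffun_map i2 z.1 + scale_map a z.2, - i (p z.2)).
  by congr pair; rewrite /= ?add0r.
have pcE z : ffun_map p (ffun_map i2 z.1 + scale_map a z.2) = scale_map a (p z.2).
  by rewrite linearD (se0 _ bE) add0r scale_map_natural.
have [z|h hE] := @factor_inj _ _ _ _ l c lI.
  apply/lE; rewrite qE cE; apply/gE; exists (- p z.2).
  by rewrite cone_mapE pcE !linearN opprK.
exists h; split.
- by apply: linear_inj0 => x [_ ix]; case: ip => i2I' _ _; apply: i2I'; rewrite linear0.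
- move=> [z y]; split=> [/(congr1 l)|[k]]; last first.
    rewrite cone_mapE => -[<- <-]; apply: lI; rewrite hE cE linear0 [_.2]/=.
    by rewrite (se0 k ip) linear0 oppr0 linearN scale_map_natural addNr.
  rewrite hE cE linear0 => -[E1 E2].
  have py : p y = 0.
    apply: gI; rewrite linear0 cone_mapE; congr pair; last by rewrite -[LHS]opprK E2 oppr0.
    by rewrite -(pcE (z, y)) E1 linear0 oppr0.
  have [k ky] := (pE y).1 py; exists k; rewrite cone_mapE; congr pair => //.
  have [b1 _ _] := bE; apply: b1; rewrite linearN -scale_map_natural.
  by rewrite ky; apply/eqP; rewrite eq_sym -addr_eq0; apply/eqP.
move=> x; case wt : (l x) => [w t].
have /lE : exists y, l y = (w, t) by exists x.
rewrite qE => /gE [k]; rewrite cone_mapE => kwt.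
have kw : - scale_map a k = ffun_map p w := congr1 fst kwt.
have kt : i k = t := congr1 snd kwt.
have [y yk] := pS (- k); have [_ bE2 _] := bE.
have [|z zE] := (bE2 (w - scale_map a y)).1.
  by rewrite linearB -scale_map_natural yk -kw linearN subrr.
exists (z, y); apply: lI; rewrite hE cE wt /= yk linearN opprK kt.
by congr pair; rewrite -[X in _ = X](subrK (scale_map a y)) -zE.
Qed.

Lemma ext_vanish_cone b (a : 'I_b -> R) K P N (i : {linear K -> P}) (p : {linear P -> N})
    L M j :
    (forall j, a j \in m) -> fin_gen M -> fin_gen K -> projective P ->
    short_exact i p -> cone a i L -> ext_vanish M j L ->
  ext_vanish M j N.
Proof.
move=> ma fgM; elim: j K P N i p L => [|j IH] K P N i p L fgK prP ip coneL EL.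
  apply: ext_vanish0_presentation prP ip _; apply: cone_extend ma coneL _ EL.
  exact: fin_gen_homR.
apply: (ext_vanishS prP ip).
have /fin_genP [n [q qS]] := fgK.
have [K2 [i2 i2q]] := exists_presentation qS; have [i2I _ _] := i2q.
have [L2 [l [r [lr cone2]]]] := cone_step i2q coneL.
apply: IH i2q cone2 _; first exact: (fin_gen_sub noethR (fin_gen_free R n) i2I).
- exact: free_projective.
by apply: EL lr; apply: projective_pair => //; apply/projective_ffun/free_projective.
Qed.

(** For [b = 1] this is Nakayama with the exact sequence Ext^(j+1)(N, M) -> Ext^(j+1)(N, M) ->
    Ext^(j+2)(C, M). In general the kernel [L] of [P^b -> C] is spanned by [K^b] and the image of
    [P] under [scale_map a], and so is the cone of [K -> P]. *)
Lemma ext_vanish_scale b (a : 'I_b -> R) N C (c : {linear {ffun 'I_b -> N} -> C}) M j :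
    (forall j, a j \in m) -> fin_gen M -> fin_gen N ->
    short_exact (scale_map a) c -> ext_vanish M j.+1 C ->
  ext_vanish M j N.
Proof.
move=> ma fgM fgN ac EC; have /fin_genP [n [p pS]] := fgN.
have [K [i ip]] := exists_presentation pS; have [iI pE _] := ip.
have bp := se_ffun_map b ip.
have [L [l [phi [psi [lc pp lphi psil]]]]] := se_preimage bp ac.
have [lI lE _] := lc; have [bI bE _] := bp; have [aI _ _] := ac.
pose u : {linear ({ffun 'I_b -> K} * free R n)%type -> {ffun 'I_b -> free R n}} :=
  copair_lin (ffun_map i) (scale_map a).
have uE z : u z = ffun_map i z.1 + scale_map a z.2 by [].
have puE z : ffun_map p (u z) = scale_map a (p z.2).
  by rewrite uE linearD (se0 _ bp) add0r scale_map_natural.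
have [z|g gE] := @factor_inj _ _ _ _ l u lI.
  by apply/lE; rewrite /= -[LHS]/(c (ffun_map p (u z))) puE (se0 _ ac).
have fgK : fin_gen K by exact: (fin_gen_sub noethR (fin_gen_free R n) iI).
apply: (ext_vanish_cone (L := L) ma fgM fgK (@free_projective R n) ip); last first.
  by apply: EC lc; apply/projective_ffun/free_projective.
exists g; split.
- by apply: linear_inj0 => x [_ ix]; apply: iI; rewrite linear0.
- move=> z; split=> [/(congr1 l)|[k <-]]; last first.
    by apply: lI; rewrite gE linear0 cone_mapE uE [_.1]/= [_.2]/= linearN scale_map_natural addNr.
  rewrite gE linear0 => uz.
  have [|k kz] := (pE z.2).1; first by apply: aI; rewrite -puE uz !linear0.
  exists k; rewrite cone_mapE [z]surjective_pairing kz; congr pair; apply: bI.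
  rewrite linearN -scale_map_natural kz; apply/eqP.
  by rewrite eq_sym -addr_eq0 -uE uz.
move=> x; have [y py] := pS (psi x).
have [|z zE] := (bE (l x - scale_map a y)).1.
  by rewrite linearB -scale_map_natural -psil py subrr.
by exists (z, y); apply: lI; rewrite gE uE zE subrK.
Qed.

(** * Finite injective dimension, by Noetherian induction on ideals *)

Lemma projective_zero P : (forall p : P, p = 0) -> projective P.
Proof.
by move=> P0 A B g u _; exists \0 => p; rewrite (P0 p) !linear0.
Qed.

Lemma exists_cyclic (I : R -> Prop) : is_ideal I ->
  exists (Q : lmodType R) (q : {linear R^o -> Q}), surj q /\ (forall x, q x = 0 <-> I x).
Proof. by move=> [I0 IP]; apply: exists_quotient. Qed.

Lemma residue_field_proj :
  exists p : {linear R^o -> residue_field m}, surj p /\ forall x, p x = 0 <-> x \in m.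
Proof.
pose S : submodule R^o := Submodule (ideal_submod_closed m).
exists (lin_of (@quotmod_pi_linear _ _ S)); split=> [z|x].
  by have [v ->] := quotmod_piP z; exists v.
exact: (quotmod_pi_eq0 S x).
Qed.

(** For x in m outside I, multiplication by x gives 0 -> R/(I:x) -> R/I -> R/(I+xR) -> 0. The outer
    ideals are strictly larger than I unless (I:x) = I; in that case x is regular on R/I and
    [ext_vanish_scale] applies. This replaces a prime filtration. *)
Lemma ext_vanish_cyclic M j0 : fin_gen M ->
    (forall j, (j0 <= j)%N -> ext_vanish M j (residue_field m)) ->
  forall I, is_ideal I -> forall (Q : lmodType R) (q : {linear R^o -> Q}),
    surj q -> (forall x, q x = 0 <-> I x) ->
  forall j, (j0 <= j)%N -> ext_vanish M j Q.
Proof.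
move=> fgM Ek; apply: (ideal_noetherian_ind noethR) => I [I0 IP] IH Q q qS qE j j0j.
have [I1|I1] := pselect (I 1).
  apply/ext_vanish_projective/projective_zero => z; have [x <-] := qS z.
  by apply/qE; have := IP x 1 0 I1 I0; rewrite mulr1 addr0.
(* If there is no such x, then I = m and [Q] is the residue field. *)
have [[x [mx Ix]]|noz] := pselect (exists x, x \in m /\ ~ I x); last first.
  have Im x : x \in m <-> I x.
    split=> [mx|Ix]; first by apply: contrapT => Ix; apply: noz; exists x.
    exact: local_proper Ix.
  have [p [pS pm]] := residue_field_proj.
  have piE x : p x = 0 <-> I x by rewrite pm Im.
  have [x /piE /qE //|e eE] := factor_surj (f := q) pS.
  have [x /qE /piE //|e' e'E] := factor_surj (f := p) qS.
  apply: (@ext_vanish_iso _ _ _ _ _ e e') (Ek _ j0j) => [z|z].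
    by have [x <-] := pS z; rewrite eE e'E.
  by have [x <-] := qS z; rewrite e'E eE.
pose J z := exists r i, I i /\ z = r * x + i.
have Ji : is_ideal J.
  split=> [|a u v [r [i [Ii ->]]] [r' [i' [Ii' ->]]]].
    by exists 0, 0; rewrite mul0r addr0.
  exists (a * r + r'), (a * i + i'); split; first exact: IP.
  by rewrite mulrDr mulrDl mulrA addrACA.
have [C [c [cS cE]]] := exists_cyclic Ji.
have EC l : (j0 <= l)%N -> ext_vanish M l C.
  apply: (IH J) cS cE l => // [i Ii|]; first by exists 0, i; rewrite mul0r add0r.
  by exists x; split=> //; exists 1, 0; rewrite mul1r addr0.
have [i /qE Ii|g gE] := factor_surj (f := c) qS.
  by apply/cE; exists 0, i; rewrite mul0r add0r.
have gS : surj g by move=> z; have [r <-] := cS z; exists (q r).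
pose J' z := I (z * x).
have J'i : is_ideal J'.
  by split=> [|a u v Iu Iv]; rewrite /J' ?mul0r // mulrDl -mulrA; apply: IP.
have [A [s [sS sE]]] := exists_cyclic J'i.
have qx z : q (z * x) = x *: q z by rewrite mulrC -linearZ.
have [z /sE Iz|f fE] := factor_surj (f := (x \*: q : {linear R^o -> Q})) sS.
  by rewrite /= -qx; apply/qE.
have fg : short_exact f g.
  split=> //.
    apply: linear_inj0 => z; have [r <-] := sS z; rewrite fE /= -qx => /qE Ir.
    exact/sE.
  move=> y; have [r <-] := qS y; rewrite gE cE; split=> [[t [i [Ii ->]]]|[z]].
    by exists (s t); rewrite fE /= -qx linearD [q i](qE i).2 // addr0.
  have [t <-] := sS z; rewrite fE /= -qx => tr.
  exists t, (r - t * x); split; last by rewrite addrC subrK.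
  by apply/qE; rewrite linearB tr subrr.
have [[y [J'y Iy]]|reg] := pselect (exists y, J' y /\ ~ I y).
  apply: ext_vanish_extension fg _ (EC j j0j).
  apply: (IH J') sS sE j j0j => // [i Ii|]; last by exists y.
  by rewrite /J' mulrC -[_ * _]addr0; apply: IP.
(* Here (I:x) = I, so x acts injectively on R/I. *)
have qsE z : s z = 0 -> q z = 0.
  by move=> /sE J'z; apply/qE; apply: contrapT => Iz; apply: reg; exists z.
have fgQ : fin_gen Q.
  apply: (fin_gen_surj (f := q)) => //; exists 1%N, (fun=> 1) => z.
  by exists (fun=> z); rewrite big_ord1; exact/esym/mulr1.
have xg : short_exact (scale_map (fun=> x : R)) (g \o ffun_ev Q (ord0 : 'I_1)).
  split.
  - apply: linear_inj0 => z; have [r <-] := qS z.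
    move=> /ffunP /(_ ord0); rewrite scale_mapE ffunE -qx => /qE Ir.
    by apply: qsE; apply/sE.
  - have [fI fE' _] := fg; move=> y /=; split=> [/fE' [z]|[z <-]].
      have [r <-] := sS z; rewrite fE => ry; exists (q r); apply/ffunP => i.
      by rewrite scale_mapE ord1 -ry.
    by rewrite scale_mapE; apply/fE'; have [r <-] := qS z; exists (s r); rewrite fE.
  - by move=> z; have [y <-] := gS z; exists [ffun=> y]; rewrite /= ffunE.
apply: ext_vanish_scale fgM fgQ xg _ => //.
(* [C] is needed one degree higher; vanishing in all degrees from [j0] on leaves room for this. *)
by apply: EC; apply: leqW.
Qed.

(** Induction on the number of generators: [Q] is the cyclic submodule generated by the first one,
    and [C] needs one generator less. *)
Lemma ext_vanish_fin_gen M j0 : fin_gen M ->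
    (forall j, (j0 <= j)%N -> ext_vanish M j (residue_field m)) ->
  forall N, fin_gen N -> forall j, (j0 <= j)%N -> ext_vanish M j N.
Proof.
move=> fgM Ek N /fin_genP [n [p pS]] j j0j.
elim: n N p pS => [|n IH] N p pS.
  apply/ext_vanish_projective/projective_zero => x; have [r <-] := pS x.
  by have -> : r = 0 by [apply/ffunP => -[]]; rewrite linear0.
have [f [g [fg f0 gl]]] := se_ffun R^o n; have [fI gE gS] := fg.
have [C [c [cS cE]]] := exists_coker (p \o f : {linear R^o -> N}).
pose I x := p (f x) = 0.
have Ii : is_ideal I.
  by split=> [|a u v]; rewrite /I ?linear0 // => Iu Iv; rewrite !linearP Iu Iv scaler0 addr0.
have [Q [q [qS qE]]] := exists_cyclic Ii.
have [x /qE //|i iE] := factor_surj (f := (p \o f : {linear R^o -> N})) qS.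
have ic : short_exact i c.
  split=> //.
    by apply: linear_inj0 => x; have [r <-] := qS x; rewrite iE => /qE.
  move=> y; rewrite cE; split=> -[x <-]; first by exists (q x); rewrite iE.
  by have [r <-] := qS x; exists r; rewrite iE.
apply: (ext_vanish_extension ic).
  exact: (ext_vanish_cyclic fgM Ek Ii qS qE).
have [x /gE [r <-]|h hE] := factor_surj (f := (c \o p : {linear free R n.+1 -> C})) gS.
  by apply/cE; exists r.
apply: (IH C h) => y; have [x <-] := cS y; have [r <-] := pS x.
by exists (g r); rewrite hE.
Qed.
End Local.

(** * Maximal Cohen-Macaulay modules are acyclic for Hom(-, Omega) *)

Section CohenMacaulay.
Variables (R : comNzRingType) (m : idealr R) (d : nat) (Omega : lmodType R).
Implicit Types A B C K L M N P Q X Y Z : lmodType R.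
Hypotheses (noethR : noetherian R) (localR : local_ring m).
Hypotheses (cmR : CM_module m d R^o) (canonicalOmega : canonical_module m d Omega).

Local Notation k := (residue_field m).

Definition depth_ge e M : Prop := forall i, (i < e)%N -> forall x : Ext k M i, x = 0.

Lemma depth_geP e M : depth_ge e M <->
  ((0 < e)%N -> forall (h : {linear k -> M}) x, h x = 0) /\
  (forall i, (i.+1 < e)%N -> ext_vanish M i k).
Proof.
split=> [De|[D0 De] [|i] ie].
- by split=> [e0|i ie]; [apply/Ext0_eq0/De | apply/ExtS_eq0/De].
- exact/Ext0_eq0/D0.
- exact/ExtS_eq0/De.
Qed.

(** The long exact sequence of Hom(k, -) lets a kernel gain one degree over the quotient. *)
Lemma depth_ge_sub e Y Z Y'' (f : {linear Y -> Z}) (g : {linear Z -> Y''}) :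
  short_exact f g -> depth_ge e.+1 Z -> depth_ge e Y'' -> depth_ge e.+1 Y.
Proof.
move=> fg /depth_geP [Z0 EZ] /depth_geP [Y0 EY]; have [fI gE gS] := fg.
apply/depth_geP; split=> [_ h x|i].
  by apply: fI; rewrite linear0 -[LHS]/((f \o h : {linear _ -> _}) x) Z0.
case: i => [|i] ie; last by apply: ext_vanish_covariant fg (EZ _ ie) (EY _ ie).
apply: (ext_vanish0_covariant fg (EZ _ ie)) => h.
by exists \0 => x; rewrite linear0 Y0.
Qed.

Lemma depth_ge_le e e' M : (e' <= e)%N -> depth_ge e M -> depth_ge e' M.
Proof. by move=> le De i ie; apply: De; apply: leq_trans le. Qed.

Lemma depth_ge_pair e M M' :
  depth_ge e M -> depth_ge e M' -> depth_ge e (M * M')%type.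
Proof.
move=> /depth_geP [M0 EM] /depth_geP [M'0 EM']; apply/depth_geP; split=> [e0 h x|i ie].
  rewrite [h x]surjective_pairing -[(h x).1]/((fst \o h : {linear _ -> M}) x).
  by rewrite -[(h x).2]/((snd \o h : {linear _ -> M'}) x) M0 // M'0.
by apply: ext_vanish_pair_target; [apply: EM | apply: EM'].
Qed.

Lemma depth_ge_ffun e n M : depth_ge e M -> depth_ge e {ffun 'I_n -> M}.
Proof.
move=> /depth_geP [M0 EM]; apply/depth_geP; split=> [e0 h x|i ie].
  apply/ffunP => j; rewrite ffunE.
  by rewrite -[LHS]/((ffun_ev M j \o h : {linear _ -> M}) x) M0.
exact/ext_vanish_ffun_target/EM.
Qed.

Lemma CM_free n : CM_module m d (free R n).
Proof. by split; [exact: fin_gen_free | apply: depth_ge_ffun; case: cmR]. Qed.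

Lemma CM_ker Y Z Y'' (f : {linear Y -> Z}) (g : {linear Z -> Y''}) :
  short_exact f g -> CM_module m d Z -> CM_module m d Y'' -> CM_module m d Y.
Proof.
move=> fg [fgZ DZ] [_ DY]; have [fI _ _] := fg.
split; first exact: (fin_gen_sub noethR fgZ fI).
(* For d = 0 there is no depth condition; otherwise depth d - 1 of the quotient suffices. *)
move: DZ DY; case: (d) => [|e] DZ DY //.
by apply: depth_ge_sub fg DZ _; apply: depth_ge_le DY.
Qed.

Lemma fin_gen_Omega : fin_gen Omega. Proof. by case: canonicalOmega => [[]]. Qed.

Lemma ext_vanish_residue j : (d <= j)%N -> ext_vanish Omega j k.
Proof.
(* Index [j] stands for Ext^(j+1), and j + 1 > d; a k-basis without elements leaves only 0. *)
move=> dj; apply/ExtS_eq0 => x; have [_ /(_ j.+1)] := canonicalOmega.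
rewrite gtn_eqF ?ltnS // => -[e [/(_ x) [r ->] _]].
exact: big_ord0.
Qed.

Lemma ext_vanish_Omega N j : fin_gen N -> (d <= j)%N -> ext_vanish Omega j N.
Proof.
by move=> fgN; apply: (ext_vanish_fin_gen noethR localR fin_gen_Omega ext_vanish_residue fgN).
Qed.

Lemma precomp_subproof A B X (f : {linear A -> B}) :
  linear (fun h : homR B X => (h : {linear B -> X}) \o f : homR A X).
Proof. by move=> a g h; apply: homR_eq. Qed.

Definition precomp A B X (f : {linear A -> B}) : {linear homR B X -> homR A X} :=
  lin_of (@precomp_subproof A B X f).

Lemma precompE A B X (f : {linear A -> B}) (h : homR B X) x : precomp X f h x = h (f x).
Proof. by []. Qed.

Lemma lincomb_homR_subproof n X :
  linear (fun y : {ffun 'I_n -> X} => lincomb y : homR (free R n) X).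
Proof.
move=> a y z; apply: homR_eq => r /=; rewrite scaler_sumr -big_split.
by apply: eq_bigr => i _; rewrite /= !ffunE scalerDr scalerA mulrC -scalerA.
Qed.

Definition lincomb_homR n X : {linear {ffun 'I_n -> X} -> homR (free R n) X} :=
  lin_of (@lincomb_homR_subproof n X).

Lemma lincomb_homR_inv n X (h : homR (free R n) X) :
  lincomb_homR n X [ffun i => h (unit_vec R i)] = h.
Proof.
apply: homR_eq => r; rewrite (lincomb_linear h) /=; apply: eq_bigr => i _.
by rewrite ffunE.
Qed.

Lemma ext_vanish_homR_free M n X i :
  ext_vanish M i X -> ext_vanish M i (homR (free R n) X).
Proof.
move=> /(@ext_vanish_ffun _ _ _ n).
have resL : linear (fun f : homR (free R n) X => [ffun i => f (unit_vec R i)]).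
  by move=> c f g; apply/ffunP => j; rewrite !ffunE.
apply: (@ext_vanish_iso _ _ _ _ _ (lincomb_homR n X) (lin_of resL)) => [y|h].
  by apply/ffunP => j; rewrite /= ffunE -[LHS]/(lincomb y _) lincomb_unit_vec.
exact: lincomb_homR_inv.
Qed.

(* With Q -> P -> N the start of a free resolution, the cokernel of
   Hom(P, X) -> Hom(Q, X) embeds in the next term of Hom(-, X) as long as
   Ext(N, X) vanishes, and dimension shifting applies. *)
Lemma ext_vanish_coker X t N P K n (i : {linear K -> P}) (p : {linear P -> N})
    (q : {linear free R n -> K}) C (c : {linear homR (free R n) X -> C}) :
    fin_gen X -> (forall j, (0 < j)%N -> ext_vanish Omega j X) ->
    projective P -> short_exact i p -> surj q -> surj c ->
    (forall h, c h = 0 <-> exists g : homR P X, forall r, g (i (q r)) = h r) ->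
    (forall j, (j < t)%N -> ext_vanish X j N) ->
  forall j, (0 < j)%N -> (d <= j + t)%N -> ext_vanish Omega j C.
Proof.
(* [t] counts the vanishing groups Ext(N, X) still to be spent: each shift uses one and raises the
   degree by one, until the injective dimension takes over at [t = 0]. *)
move=> fgX EX; elim: t N P K n i p q C c => [|t IH] N P K n i p q C c prP ip qS cS cE EN j j0 dj.
  apply: ext_vanish_Omega; last by rewrite -[j]addn0.
  exact: fin_gen_surj (fin_gen_homR noethR (fin_gen_free R n) fgX) cS.
have [K2 [i2 i2q]] := exists_presentation qS; have [i2I qE _] := i2q.
have [l [q2 q2S]] := (fin_genP _).1 (fin_gen_sub noethR (fin_gen_free R n) i2I).
pose v : {linear homR (free R n) X -> homR (free R l) X} :=
  precomp X (i2 \o q2 : {linear free R l -> free R n}).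
have [C2 [c2 [c2S c2E]]] := exists_coker v.
have [h /cE [g gE]|w wE] := factor_surj (f := v) cS.
  by apply: homR_eq => r; rewrite /= -gE (se0 _ i2q) !linear0.
have wc2 : short_exact w c2.
  split=> //.
    apply: linear_inj0 => x; have [h <-] := cS x; rewrite wE => /homR0_eq vh.
    have [r /qE [y <-]|h' h'E] := factor_surj (f := h : {linear _ -> _}) qS.
      by have [z <-] := q2S y; exact: vh.
    have [g gE] := EN 0%N isT _ _ _ _ ip h'.
    by apply/cE; exists g => r; rewrite gE.
  move=> y; rewrite c2E; split=> -[h <-]; first by exists (c h); rewrite wE.
  by have [h' <-] := cS h; exists h'; rewrite wE.
apply: ext_vanish_sub wc2 _ _; first exact/ext_vanish_homR_free/EX.
apply: (IH K (free R n) K2 l i2 q q2 C2 c2) => //; last 2 first.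
- by move=> j' j't; apply: (EN j'.+1) ip.
- by rewrite addSnnS.
- exact: free_projective.
move=> h; rewrite c2E; split=> -[g gE]; exists g; first by rewrite -gE.
by apply: homR_eq => r; rewrite -gE.
Qed.

Lemma regular_projective : projective (R^o : lmodType R).
Proof.
move=> A B g u gS; have [a ga] := gS (u 1).
have aL : linear (fun r : R^o => (r : R) *: a) by move=> c r s; rewrite scalerDl scalerA.
exists (lin_of aL) => r; rewrite /= linearZ ga -linearZ; congr (u _).
exact: mulr1.
Qed.

Lemma CM_ext_vanish_step X : CM_module m d X ->
  (forall j, (0 < j)%N -> ext_vanish Omega j X) -> ext_vanish Omega 0 X.
Proof.
move=> [fgX DX] EX; have [d0|dgt0] := posnP d.
  by apply: ext_vanish_Omega => //; rewrite d0.
have [X0 Ek] := (depth_geP _ _).1 DX.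
have [p [pS pm]] := residue_field_proj m.
have [K [i ip]] := exists_presentation pS; have [iI pE _] := ip.
have mE x : x \in m <-> exists y, i y = x by rewrite -pm; exact: pE.
have fgR : fin_gen R^o by case: cmR.
have [n [q qS]] := (fin_genP _).1 (fin_gen_sub noethR fgR iI).
have [C [c [cS cE]]] := exists_coker (precomp X (i \o q : {linear free R n -> R^o})).
pose a j : R := i (q (unit_vec R j)).
have qE r : i (q r) = \sum_j r j * a j.
  have -> : i (q r) = (i \o q : {linear free R n -> R^o}) r by [].
  by rewrite lincomb_linear.
have EC : ext_vanish Omega 1 C.
  (* The depth of X provides the d - 1 vanishing groups Ext^1(k, X), ..., Ext^(d-1)(k, X); from
     index 1 they reach exactly d. *)
  apply: (ext_vanish_coker fgX EX regular_projective ip qS cS _ (t := d.-1)) => //.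
  - move=> h; rewrite cE; split=> -[g gE]; exists g; first by rewrite -gE.
    by apply: homR_eq => r; rewrite -gE.
  - by move=> j jd; apply: Ek; rewrite -ltn_predRL.
  - by rewrite add1n prednK.
apply: (ext_vanish_scale noethR localR (a := a) (c := c \o lincomb_homR n X)) EC => //.
- by move=> j; apply/mE; exists (q (unit_vec R j)).
- exact: fin_gen_Omega.
split.
(* An element killed by the generators of m defines a map k -> X, which is 0 because the depth is
   positive. *)
- apply: linear_inj0 => x ax.
  have mx z : z \in m -> z *: x = 0.
    move=> /mE [y <-]; have [r <-] := qS y; rewrite qE scaler_suml big1 // => j _.
    by rewrite -scalerA -(scale_mapE a x j) ax ffunE scaler0.
  have xL : linear (fun r : R^o => (r : R) *: x) by move=> b r s; rewrite scalerDl scalerA.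
  have [r /pE /mE /mx //|h hE] := factor_surj (f := lin_of xL) pS.
  by rewrite -[x]scale1r -[LHS]/(lin_of xL 1) -hE X0.
- move=> y; rewrite /= cE; split=> [[h hE]|[x <-]].
    exists (h 1); apply/ffunP => j; rewrite scale_mapE -linearZ.
    have := congr1 (fun u : homR _ _ => u (unit_vec R j)) hE.
    rewrite precompE /= -[X in _ = X -> _]/(lincomb y _) lincomb_unit_vec => <-.
    by congr (h _); exact: mulr1.
  have xL : linear (fun r : R^o => (r : R) *: x) by move=> b r s; rewrite scalerDl scalerA.
  exists (lin_of xL); apply: homR_eq => r; rewrite precompE /= qE scaler_suml.
  by apply: eq_bigr => j _; rewrite scale_mapE scalerA.
move=> z; have [h <-] := cS z; exists [ffun i => h (unit_vec R i)] => /=.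
by congr (c _); exact: lincomb_homR_inv.
Qed.

Lemma exists_syzygy X : CM_module m d X ->
  exists (K : lmodType R) n (i : {linear K -> free R n}) (p : {linear free R n -> X}),
    CM_module m d K /\ short_exact i p.
Proof.
move=> cmX; have [n [p pS]] := (fin_genP _).1 cmX.1.
have [K [i ip]] := exists_presentation pS; exists K, n, i, p; split=> //.
exact: CM_ker ip (CM_free n) cmX.
Qed.

(** The induction is on the degree from which on vanishing is known, for all of CM at once. The
    syzygy of X lies in CM with this bound lowered by one, so only Ext^1(X, Omega) is left, and
    [CM_ext_vanish_step] removes it. *)
Lemma CM_ext_vanish X i : CM_module m d X -> ext_vanish Omega i X.
Proof.
suff H n : CM_module m d X -> (forall j, (n <= j)%N -> ext_vanish Omega j X) ->
    forall j, ext_vanish Omega j X.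
  move=> cmX; apply: (H d) => // j; exact: ext_vanish_Omega cmX.1.
elim: n X {i} => [|n IH] X cmX EX j; first exact: EX.
have [K [l [f [p [cmK fp]]]]] := exists_syzygy cmX.
have EK := IH K cmK (fun i ni => EX i.+1 ni _ _ _ _ (@free_projective R l) fp).
have ES i : ext_vanish Omega i.+1 X.
  by apply: ext_vanishS (@free_projective R l) fp _.
by case: j => // ; apply: CM_ext_vanish_step => // -[].
Qed.
End CohenMacaulay.

(** * Linear compactness over a complete local ring *)

Section LinearCompactness.
Variable R : comNzRingType.
Implicit Types A B C V W : lmodType R.

(** A nonempty set of this kind is a coset of a submodule; the three-point form does not name the
    submodule and passes to images and preimages. *)
Definition affine V (S : V -> Prop) : Prop :=
  forall a x y z, S x -> S y -> S z -> S (x + a *: (y - z)).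

Lemma linear_affine V W (f : {linear V -> W}) a x y z :
  f (x + a *: (y - z)) = f x + a *: (f y - f z).
Proof. by rewrite linearD linearZ linearB. Qed.

Definition filter_base V (F : (V -> Prop) -> Prop) : Prop :=
  (exists S, F S) /\ forall S T, F S -> F T ->
    exists U, [/\ F U, forall x, U x -> S x & forall x, U x -> T x].

(* P x := (x = 0) is the usual notion; a larger P restricts it to families of
   sets stable under translation by P. *)
Definition linearly_compact V (P : V -> Prop) : Prop :=
  forall F : (V -> Prop) -> Prop, filter_base F ->
    (forall S, F S -> [/\ affine S, exists x, S x & forall x y, S x -> P (y - x) -> S y]) ->
  exists x, forall S, F S -> S x.

(** First a common point [c] of the images in [C] is found, then a common point of the traces on the
    fibre over [c], which is a translate of [A]. *)
Lemma linearly_compact_se A B C (f : {linear A -> B}) (g : {linear B -> C})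
    (PA : A -> Prop) (PB : B -> Prop) (PC : C -> Prop) :
    short_exact f g ->
    (forall a, PA a -> PB (f a)) -> (forall c, PC c -> exists b, PB b /\ g b = c) ->
  linearly_compact PA -> linearly_compact PC -> linearly_compact PB.
Proof.
move=> [fI gE gS] PAB PBC LA LC F [[S0 FS0] Fdir] FP.
have [||c cP] := LC (fun T => exists S, F S /\ T = (fun c => exists b, S b /\ g b = c)).
- split; first by eexists; exists S0.
  move=> _ _ [S [FS ->]] [T [FT ->]]; have [U [FU US UT]] := Fdir S T FS FT.
  eexists; split; first by exists U.
    by move=> _ [b [/US Sb <-]]; exists b.
  by move=> _ [b [/UT Tb <-]]; exists b.
- move=> _ [S [FS ->]]; have [Sa [x Sx] SP] := FP S FS; split.
  + move=> a _ _ _ [u [Su <-]] [v [Sv <-]] [w [Sw <-]].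
    by exists (u + a *: (v - w)); rewrite linear_affine; split=> //; apply: Sa.
  + by exists (g x), x.
  + move=> _ y [z [Sz <-]] /PBC [b [Pb gb]]; exists (z + b).
    split; first by apply: SP Sz _; rewrite addrC addKr.
    by rewrite linearD gb addrC subrK.
have [b0 gb0] := gS c.
have [||a aP] := LA (fun T => exists S, F S /\ T = (fun a => S (b0 + f a))).
- split; first by eexists; exists S0.
  move=> _ _ [S [FS ->]] [T [FT ->]]; have [U [FU US UT]] := Fdir S T FS FT.
  by eexists; split; [exists U | move=> a /US | move=> a /UT].
- move=> _ [S [FS ->]]; have [Sa _ SP] := FP S FS; split.
  + move=> a x y z Sx Sy Sz; have := Sa a _ _ _ Sx Sy Sz.
    by rewrite linear_affine [b0 + f y]addrC opprD addrA addrK addrA.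
  + have [b [Sb gb]] := cP _ (ex_intro _ S (conj FS erefl)).
    have [|a fa] := (gE (b - b0)).1; first by rewrite linearB gb gb0 subrr.
    by exists a; rewrite fa [X in S X]addrC subrK.
  + by move=> x y Sx /PAB Pxy; apply: SP Sx _; rewrite [b0 + f y]addrC opprD addrA addrK -linearB.
by exists (b0 + f a) => S FS; apply: (aP (fun a => S (b0 + f a))); exists S.
Qed.

Lemma linearly_compact_ffun V n (P : V -> Prop) : P 0 -> linearly_compact P ->
  linearly_compact (fun x : {ffun 'I_n -> V} => forall i, P (x i)).
Proof.
move=> P0 LV; elim: n => [|n IH].
  move=> F _ FP; exists 0 => S /FP [_ [x Sx] _].
  by have -> : 0 = x :> {ffun 'I_0 -> V} by apply/ffunP => -[].
have [f [g [fg f0 gl]]] := se_ffun V n; have [fI gE gS] := fg.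
apply: (linearly_compact_se fg _ _ LV IH) => [v Pv i|y Py].
  have [j ->|->] := unliftP ord0 i; last by rewrite f0.
  by rewrite -gl (se0 _ fg) ffunE.
exists [ffun i => if unlift ord0 i is Some j then y j else 0]; split=> [i|].
  by rewrite ffunE; case: unliftP.
by apply/ffunP => i; rewrite gl ffunE liftK.
Qed.

Lemma linearly_compact_surj V W (f : {linear V -> W}) : surj f ->
  linearly_compact (fun x : V => x = 0) -> linearly_compact (fun x : W => x = 0).
Proof.
move=> fS LV F [[S0 FS0] Fdir] FP.
have [||v vP] := LV (fun T => exists S, F S /\ T = (fun a => S (f a))).
- split; first by eexists; exists S0.
  move=> _ _ [S [FS ->]] [T [FT ->]]; have [U [FU US UT]] := Fdir S T FS FT.
  by eexists; split; [exists U | move=> a /US | move=> a /UT].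
- move=> _ [S [FS ->]]; have [Sa [x Sx] SP] := FP S FS; split.
  + move=> a u v w Su Sv Sw; rewrite linear_affine; exact: Sa.
  + by have [v fv] := fS x; exists v; rewrite fv.
  + by move=> x' y Sx' /eqP; rewrite subr_eq0 => /eqP ->.
by exists (f v) => S FS; apply: (vP (fun a => S (f a))); exists S.
Qed.

Variable m : idealr R.
Hypotheses (noethR : noetherian R) (localR : local_ring m) (completeR : adic_complete m).

(** This is linear compactness of k without the quotient: an affine set stable under m is one class
    modulo m or, having two points that differ by a unit, all of R. *)
Lemma linearly_compact_residue : linearly_compact (fun x : R^o => (x : R) \in m).
Proof.
move=> F [[S0 FS0] Fdir] FP.
have [[S [FS Sm]]|nS] := pselect (exists S, F S /\ forall x y, S x -> S y -> (x - y : R) \in m).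
  have [_ [x Sx] _] := FP S FS; exists x => T FT; have [U [FU US UT]] := Fdir S T FS FT.
  have [_ [z Uz] _] := FP U FU; have [_ _ TP] := FP T FT.
  by apply: TP (UT _ Uz) _; apply: Sm => //; apply: US.
exists 0 => S FS; have [Sa _ _] := FP S FS.
have [x [y [Sx [Sy xy]]]] : exists x y, S x /\ S y /\ (x - y : R) \notin m.
  apply: contrapT => H; apply: nS; exists S; split=> // x y Sx Sy.
  by apply: contrapT => /negP xy; apply: H; exists x, y.
have [z xyz] := local_unit noethR localR xy.
have := Sa (- x * z : R) _ _ _ Sx Sx Sy.
by rewrite -[_ *: _]/((- x * z) * (x - y) : R) -mulrA (mulrC z) xyz mulr1 subrr.
Qed.

Lemma ideal_pow_is_ideal e : is_ideal (ideal_pow m e).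
Proof.
split=> [|a _ _ [k [r [b [mb ->]]]] [k' [r' [b' [mb' ->]]]]].
  by exists 0%N, (fun=> 0), (fun _ _ => 0); split=> [[]//|]; rewrite big_ord0.
exists (k + k')%N, (fun i => match split i with inl j => a * r j | inr j => r' j end),
  (fun i => match split i with inl j => b j | inr j => b' j end).
split=> [i j|]; first by case: split.
rewrite big_split_ord mulr_sumr; congr (_ + _); apply: eq_bigr => i _ /=.
  by rewrite (unsplitK (inl i)) mulrA.
by rewrite (unsplitK (inr i)).
Qed.

Lemma ideal_pow0 x : ideal_pow m 0 x.
Proof.
exists 1%N, (fun=> x), (fun _ _ => 0); split=> [_ []//|].
by rewrite big_ord1 big_ord0 mulr1.
Qed.

Lemma ideal_powS e b x : b \in m -> ideal_pow m e x -> ideal_pow m e.+1 (b * x).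
Proof.
move=> mb [k [r [a [ma ->]]]].
exists k, r, (fun i j => if unlift ord0 j is Some l then a i l else b); split=> [i j|].
  by case: unliftP.
rewrite mulr_sumr; apply: eq_bigr => i _; rewrite big_ord_recl unlift_none mulrCA.
by congr (_ * (_ * _)); apply: eq_bigr => j _; rewrite liftK.
Qed.

Lemma ideal_pow_separated x : (forall e, ideal_pow m e x) -> x = 0.
Proof.
move=> xe; have [e|y [_ yU]] := completeR (x := fun=> 0).
  by rewrite subrr; case: (ideal_pow_is_ideal e).
rewrite -(yU x) ?(yU 0) // => e; rewrite subr0 //.
by case: (ideal_pow_is_ideal e).
Qed.

(** Successive approximation: [Inv e y] says that [y] meets every set of the family modulo m^e. The
    limit of the approximations exists by completeness, and lies in each set because the set is
    stable under some m^e. *)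
Lemma linearly_compact_adic n (F : (free R n -> Prop) -> Prop) : filter_base F ->
    (forall S, F S -> [/\ affine S, exists x, S x &
       exists e, forall x y, S x -> (forall i, ideal_pow m e ((y - x) i)) -> S y]) ->
  exists x, forall S, F S -> S x.
Proof.
move=> Fb FP; have [[S0 FS0] Fdir] := Fb.
pose Pw e (x : free R n) := forall i, ideal_pow m e (x i : R).
have PwL e a x y : Pw e x -> Pw e y -> Pw e (a *: x + y).
  by move=> Px Py i; rewrite !ffunE; apply: (ideal_pow_is_ideal e).2.
have PwD e x y : Pw e x -> Pw e y -> Pw e (x + y).
  by move=> Px Py; rewrite -[x]scale1r; apply: PwL.
have Pw0 e : Pw e 0 by move=> i; rewrite ffunE; case: (ideal_pow_is_ideal e).
have PwN e x : Pw e x -> Pw e (- x).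
  by move=> Px; rewrite -[- x]addr0 -scaleN1r; apply: PwL.
pose Inv e y := forall S, F S -> exists x, S x /\ Pw e (x - y).
have step (z : nat * free R n) : exists y', Inv z.1 z.2 -> Pw z.1 (y' - z.2) /\ Inv z.1.+1 y'.
  case: z => e y /=; have [Iy|] := pselect (Inv e y); last by exists 0.
  have [s [g [gm gP]]] := ideal_gen noethR (ideal_pow_is_ideal e).
  have thL : linear (fun c : {ffun 'I_n -> free R s} =>
      [ffun i => \sum_j (c i j : R) * g j] : free R n).
    move=> a c c'; apply/ffunP => i; rewrite !ffunE scaler_sumr -big_split.
    by apply: eq_bigr => j _; rewrite /= !ffunE mulrDl -mulrA.
  pose th := lin_of thL.
  have thP c : Pw e (th c).
    by move=> i; rewrite /= ffunE; apply: ideal_sum => //; apply: ideal_pow_is_ideal.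
  have thS x : Pw e x -> exists c, th c = x.
    move=> Px; have [c cE] := choice (fun i => gP _ (Px i)).
    exists [ffun i => [ffun j => c i j]]; apply/ffunP => i; rewrite /= ffunE cE.
    by apply: eq_bigr => j _; rewrite !ffunE.
  (* The correction of [y] is a vector over m^e, written in generators [g] of m^e. Modulo m^(e+1)
     only its coefficients modulo m matter, and these range over a finite power of k. *)
  have LCs := @linearly_compact_ffun _ n _ _
    (@linearly_compact_ffun _ s _ (idealr0 m) linearly_compact_residue).
  have [|||c cP] := LCs _ (fun T => exists S, F S /\
    T = (fun c => exists x, S x /\ Pw e.+1 (x - (y + th c)))).
  - by move=> i; rewrite ffunE idealr0.
  - split; first by eexists; exists S0.
    move=> _ _ [S [FS ->]] [T [FT ->]]; have [U [FU US UT]] := Fdir S T FS FT.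
    eexists; split; first by exists U.
      by move=> c [x [/US Sx Px]]; exists x.
    by move=> c [x [/UT Sx Px]]; exists x.
  - move=> _ [S [FS ->]]; have [Sa Sn _] := FP S FS; split.
    + move=> a c1 c2 c3 [x1 [S1 P1]] [x2 [S2 P2]] [x3 [S3 P3]].
      exists (x1 + a *: (x2 - x3)); split; first exact: Sa.
      have -> : x1 + a *: (x2 - x3) - (y + th (c1 + a *: (c2 - c3))) =
          a *: ((x2 - (y + th c2)) - (x3 - (y + th c3))) + (x1 - (y + th c1)).
        rewrite linear_affine.
        have -> : (x2 - (y + th c2)) - (x3 - (y + th c3)) = (x2 - x3) - (th c2 - th c3).
          rewrite opprB [y + th c3 - x3]addrC addrACA; congr (_ + _).
          by rewrite addrC [y + th c3]addrC addrKA opprB.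
        rewrite [in RHS]scalerBr [in RHS]addrACA [y + _]addrA [in LHS]opprD [x1 + _]addrC.
        by rewrite [X in _ + X = _]addrC.
      by apply: PwL => //; apply: PwD => //; apply: PwN.
    + by have [x [Sx /thS [c cE]]] := Iy S FS; exists c, x; rewrite cE opprD addrA subrr.
    + move=> c c' [x [Sx Px]] mc; exists x; split=> //.
      have -> : x - (y + th c') = (x - (y + th c)) - th (c' - c).
        by rewrite linearB opprB !opprD !addrA addrNK.
      apply: PwD => //; apply: PwN => i; rewrite /= ffunE.
      have [I0 IP] := ideal_pow_is_ideal e.+1.
      elim/big_ind: _ => [//|u v Iu Iv|j _]; first by rewrite -[u]mul1r; apply: (IP).
      by apply: ideal_powS; [exact: mc | exact: gm].
  exists (y + th c) => _; split; first by rewrite addrC addKr.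
  by move=> S FS; apply: (cP (fun c => exists x, S x /\ Pw e.+1 (x - (y + th c)))); exists S.
have [next nextP] := choice step.
pose y := fix y e := if e is e'.+1 then next (e', y e') else 0.
have yI e : Inv e (y e).
  elim: e => [|e IH]; last exact: (nextP (e, y e) IH).2.
  move=> S FS; have [_ [x Sx] _] := FP S FS; exists x; split=> // i.
  exact: ideal_pow0.
have yC i : exists z, forall e, ideal_pow m e (z - (y e i : R)).
  have [e|z [zP _]] := completeR (x := fun e => y e i); last by exists z.
  by have := (nextP (e, y e) (yI e)).1 i; rewrite !ffunE.
have [z zP] := choice yC; exists [ffun i => z i] => S FS.
have [_ _ [e SP]] := FP S FS; have [x [Sx Px]] := yI e S FS.
apply: (SP x) => // i; have [I0 IP] := ideal_pow_is_ideal e.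
have := IP (-1) _ _ (Px i) (zP i e); rewrite !ffunE mulN1r opprB.
by rewrite addrC addrA addrNK.
Qed.

Lemma ideal_pow_le e e' x : (e <= e')%N -> ideal_pow m e' x -> ideal_pow m e x.
Proof.
move=> /subnKC <-; elim: (e' - e)%N => [|l IH]; first by rewrite addn0.
rewrite addnS => -[k [r [a [ma xE]]]]; apply: IH.
exists k, (fun i => r i * a i ord0), (fun i j => a i (lift ord0 j)); split=> //.
by rewrite xE; apply: eq_bigr => i _; rewrite big_ord_recl mulrA.
Qed.

(** Compactness replaces Krull's intersection theorem: the coefficient vectors that express x modulo
    m^e in generators of I form a decreasing family, and a common one expresses x itself. *)
Lemma ideal_closed (I : R -> Prop) x : is_ideal I ->
  (forall e, exists y, I y /\ ideal_pow m e (x - y)) -> I x.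
Proof.
move=> Ii xI; have [n [g [gI gP]]] := ideal_gen noethR Ii.
pose s (c : free R n) : R := \sum_j (c j : R) * g j.
have sP a c c' : s (a *: c + c') = a * s c + s c'.
  rewrite /s mulr_sumr -big_split; apply: eq_bigr => j _ /=.
  by rewrite !ffunE mulrDl -mulrA.
have [|_ [e ->]|c cP] := @linearly_compact_adic n
  (fun S => exists e, S = (fun c => ideal_pow m e (x - s c))).
- split; first by eexists; exists 0%N.
  move=> _ _ [e ->] [e' ->]; eexists; split; first by exists (maxn e e').
    by move=> c; apply: ideal_pow_le; apply: leq_maxl.
  by move=> c; apply: ideal_pow_le; apply: leq_maxr.
- have [I0 IP] := ideal_pow_is_ideal e; split.
  + move=> a c1 c2 c3 P1 P2 P3.
    rewrite [c1 + _]addrC sP [c2 - c3]addrC -scaleN1r sP.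
    have -> : x - (a * (-1 * s c3 + s c2) + s c1) =
      a * ((x - s c2) - (x - s c3)) + (x - s c1) by ring.
    by apply: (IP) => //; rewrite addrC -mulN1r; apply: (IP).
  + have [y [/gP [r yE] Py]] := xI e; exists [ffun i => r i].
    by rewrite /s (_ : \sum_j _ = y) // yE; apply: eq_bigr => j _; rewrite ffunE.
  + exists e => c c' Pc Pcc'.
    have -> : x - s c' = -1 * s (c' - c) + (x - s c).
      by rewrite [c' - c]addrC -scaleN1r sP; ring.
    apply: (IP) => //; rewrite /s; elim/big_ind: _ => [//|u v Pu Pv|j _].
      by rewrite -[u]mul1r; apply: (IP).
    by rewrite mulrC -[_ * _]addr0; apply: (IP).
have -> : x = s c; last exact: ideal_sum.
apply/eqP; rewrite -subr_eq0; apply/eqP/ideal_pow_separated => e.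
by apply: (cP (fun c => ideal_pow m e (x - s c))); exists e.
Qed.

(** The thickenings S + m^e fall under [linearly_compact_adic]; a common point lies in the closure
    of each S, and S is a translate of an ideal, hence closed. *)
Lemma linearly_compact_regular : linearly_compact (fun x : R^o => x = 0).
Proof.
move=> F [[S0 FS0] Fdir] FP.
have [|_ [S [e [FS ->]]]|c cP] := @linearly_compact_adic 1
  (fun T => exists S e, F S /\ T = (fun c => exists x, S x /\ ideal_pow m e (x - c ord0 : R))).
- split; first by eexists; exists S0, 0%N.
  move=> _ _ [S [e [FS ->]]] [T [e' [FT ->]]]; have [U [FU US UT]] := Fdir S T FS FT.
  eexists; split; first by exists U, (maxn e e').
    move=> c [x [/US Sx Px]]; exists x; split=> //.
    by apply: ideal_pow_le Px; apply: leq_maxl.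
  move=> c [x [/UT Sx Px]]; exists x; split=> //.
  by apply: ideal_pow_le Px; apply: leq_maxr.
- have [Sa [x Sx] _] := FP S FS; have [I0 IP] := ideal_pow_is_ideal e; split.
  + move=> a c1 c2 c3 [x1 [S1 P1]] [x2 [S2 P2]] [x3 [S3 P3]].
    exists (x1 + a *: (x2 - x3)); split; first exact: Sa.
    rewrite !ffunE; set t1 := c1 _; set t2 := c2 _; set t3 := c3 _.
    have -> : x1 + a *: (x2 - x3) - (t1 + a *: (t2 - t3)) =
      a * ((x2 - t2) - (x3 - t3)) + (x1 - t1) :> R.
      by rewrite -[a *: _]/(a * _ : R) -[a *: (t2 - t3)]/(a * (t2 - t3) : R); ring.
    by apply: (IP) => //; rewrite addrC -mulN1r; apply: (IP).
  + by exists [ffun=> x], x; rewrite ffunE subrr.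
  + exists e => c c' [y [Sy Py]] Pcc'; exists y; split=> //.
    have -> : y - c' ord0 = -1 * (c' - c) ord0 + (y - c ord0) :> R by rewrite !ffunE; ring.
    exact: IP.
exists (c ord0) => S FS; have [Sa [x Sx] _] := FP S FS.
pose I (z : R) := S (x + (z : R^o)).
have Ii : is_ideal I.
  split=> [|a u v Iu Iv]; rewrite /I ?addr0 //.
  have := Sa a _ _ _ Iv Iu Sx; rewrite [x + u]addrC addrK.
  by rewrite -addrA [v + _]addrC.
have : I (c ord0 - x).
  apply: ideal_closed Ii _ => e.
  have [|y [Sy Py]] := cP (fun c => exists x, S x /\ ideal_pow m e (x - c ord0 : R)).
    by exists S, e.
  exists (y - x); split; first by rewrite /I addrC subrK.
  have [I0 IP] := ideal_pow_is_ideal e.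
  have -> : c ord0 - x - (y - x) = -1 * (y - c ord0) + 0 by ring.
  exact: IP.
by rewrite /I addrC subrK.
Qed.

Lemma linearly_compact_fin_gen V : fin_gen V -> linearly_compact (fun x : V => x = 0).
Proof.
move=> /fin_genP [n [p pS]]; apply: (linearly_compact_surj pS).
have := linearly_compact_ffun (n := n) (erefl 0) linearly_compact_regular.
move=> LC F Fb FP; apply: LC => // S FS; have [Sa Sn Sp] := FP S FS; split=> // x y Sx yx.
by apply: Sp Sx _; apply/ffunP => i; rewrite yx ffunE.
Qed.
End LinearCompactness.

(** * Modules whose finitely generated submodules factor through a class *)

Section FactorThrough.
Variables (R : comNzRingType) (C : lmodType R -> Prop).
Implicit Types A B F K M N P X : lmodType R.

Definition factors_through M : Prop :=
  forall F (phi : {linear F -> M}), fin_gen F ->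
    exists X (a : {linear F -> X}) (v : {linear X -> M}), C X /\ forall x, v (a x) = phi x.

(** The criterion is applied to the submodule generated by the tuple, so that every relation among
    the [c j] already holds in [X]. *)
Lemma factors_through_tuple M n (c : 'I_n -> M) : factors_through M ->
  exists X (x : 'I_n -> X) (v : {linear X -> M}),
    [/\ C X, forall j, v (x j) = c j &
        forall r : free R n, lincomb c r = 0 -> lincomb x r = 0].
Proof.
move=> FM.
have [||F [i [iI iE]]] := @exists_submodule R M (fun y => exists r : free R n, lincomb c r = y).
- by exists 0; rewrite linear0.
- by move=> a u v [r <-] [s <-]; exists (a *: r + s); rewrite linearP.
have [r|p pE] := @factor_inj R F M (free R n) i (lincomb c) iI.
  by apply/iE; exists r.
have [|X [a [v [CX va]]]] := FM F i.
  apply/fin_genP; exists n, p => y; have [r ry] := (iE (i y)).2 (ex_intro _ y erefl).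
  by exists r; apply: iI; rewrite pE ry.
exists X, (fun j => a (p (unit_vec R j))), v; split=> // [j|r].
  by rewrite va pE lincomb_unit_vec.
rewrite -pE -(linear0 i) => /iI pr.
rewrite -[LHS](lincomb_linear (a \o p : {linear free R n -> X})) /=.
by rewrite pr linear0.
Qed.

Variable E : lmodType R.
Hypotheses (LCE : linearly_compact (fun x : E => x = 0))
  (CE : forall X, C X -> ext_vanish E 0 X).

(* w is a possible image of the tuple b under an extension of the partial map
   with graph G. *)
Definition solution B (G : B -> E -> Prop) n (b : 'I_n -> B) (w : 'I_n -> E) : Prop :=
  forall (r : free R n) x y, G x y -> lincomb b r + x = 0 -> lincomb w r + y = 0.

(** Solvability for all finite tuples is stronger than being the graph of a partial map, and it
    survives both unions of chains and the adjunction of one element. *)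
Record extendable B (G : B -> E -> Prop) : Prop := Extendable {
  extendable0 : G 0 0;
  extendableP : forall a x y x' y', G x y -> G x' y' -> G (a *: x + x') (a *: y + y');
  extendable_solution : forall n (b : 'I_n -> B), exists w, solution G b w
}.

Lemma lincomb_affine n N (w1 w2 w3 : 'I_n -> N) a (r : free R n) :
  lincomb (fun i => w1 i + a *: (w2 i - w3 i)) r =
  lincomb w1 r + a *: (lincomb w2 r - lincomb w3 r).
Proof.
rewrite /= -sumrB scaler_sumr -big_split; apply: eq_bigr => i _ /=.
by rewrite scalerDr -scalerBr !scalerA mulrC.
Qed.

Lemma solution_affine B (G : B -> E -> Prop) n (b : 'I_n -> B) :
  affine (fun w : {ffun 'I_n -> E} => solution G b w).
Proof.
move=> a w1 w2 w3 S1 S2 S3 r x y Gxy rx.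
have -> : lincomb (w1 + a *: (w2 - w3)) r =
    lincomb (fun i => w1 i + a *: (w2 i - w3 i)) r.
  by apply: eq_bigr => i _; rewrite !ffunE.
rewrite lincomb_affine addrAC (S1 _ _ _ Gxy rx) add0r.
rewrite -[lincomb w2 r](addrK y) (S2 _ _ _ Gxy rx) -[lincomb w3 r](addrK y) (S3 _ _ _ Gxy rx).
by rewrite subrr scaler0.
Qed.

Lemma solution_ffun B (G : B -> E -> Prop) n (b : 'I_n -> B) w :
  solution G b w -> solution G b [ffun i => w i].
Proof.
move=> S r x y Gxy rx; rewrite -[RHS](S r x y Gxy rx); congr (_ + _).
by apply: eq_bigr => i _; rewrite ffunE.
Qed.

(** A larger [G] leaves fewer solutions for a fixed tuple, so the solution sets form a chain of
    nonempty affine subsets of E^n and have a common point. *)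
Lemma extendable_chain B (A : (B -> E -> Prop) -> Prop) :
    (exists G, A G) -> (forall G, A G -> extendable G) ->
    (forall G G', A G -> A G' ->
      (forall x y, G x y -> G' x y) \/ (forall x y, G' x y -> G x y)) ->
  extendable (fun x y => exists G, A G /\ G x y).
Proof.
move=> [G0 AG0] Aext Atot.
have dir G G' : A G -> A G' -> exists H, [/\ A H, forall x y, G x y -> H x y
    & forall x y, G' x y -> H x y].
  by move=> AG AG'; have [H|H] := Atot G G' AG AG'; [exists G' | exists G].
split.
- by exists G0; split=> //; apply: extendable0 (Aext _ AG0).
- move=> a x y x' y' [G [AG Gxy]] [G' [AG' Gxy']].
  have [H [AH GH G'H]] := dir G G' AG AG'; exists H; split=> //.
  by apply: (extendableP (Aext _ AH)); auto.
move=> n b.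
have [||w wP] := linearly_compact_ffun (n := n) (erefl 0) LCE
  (F := fun S => exists G, A G /\ S = (fun w : {ffun 'I_n -> E} => solution G b w)).
- split; first by eexists; exists G0.
  move=> _ _ [G [AG ->]] [G' [AG' ->]]; have [H [AH GH G'H]] := dir G G' AG AG'.
  eexists; split; first by exists H.
    by move=> w S r x y /GH; apply: S.
  by move=> w S r x y /G'H; apply: S.
- move=> _ [G [AG ->]]; split; first exact: solution_affine.
    have [w Sw] := extendable_solution (Aext _ AG) b.
    by exists [ffun i => w i]; apply: solution_ffun.
  move=> x y Sx yx; have -> : y = x; last by [].
  apply/ffunP => i; have := yx i; rewrite !ffunE => /eqP.
  by rewrite subr_eq0 => /eqP.
exists w => r x y [G [AG Gxy]]; apply: (wP (fun w : {ffun 'I_n -> E} => solution G b w)) => //.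
by exists G.
Qed.

Definition cons_tuple N n (x : N) (b : 'I_n -> N) (i : 'I_n.+1) : N :=
  if unlift ord0 i is Some j then b j else x.

Lemma lincomb_cons N n (x : N) (b : 'I_n -> N) (r : free R n.+1) :
  lincomb (cons_tuple x b) r =
  (r ord0 : R) *: x + lincomb b [ffun i => r (lift ord0 i)].
Proof.
rewrite /= big_ord_recl /cons_tuple unlift_none; congr (_ + _).
by apply: eq_bigr => i _; rewrite liftK ffunE.
Qed.

Definition cat_tuple N n k (b : 'I_n -> N) (c : 'I_k -> N) (i : 'I_(n + k)) : N :=
  match split i with inl j => b j | inr j => c j end.

Lemma lincomb_cat N n k (b : 'I_n -> N) (c : 'I_k -> N) (r : free R (n + k)) :
  lincomb (cat_tuple b c) r =
  lincomb b [ffun i => r (lshift k i)] + lincomb c [ffun i => r (rshift n i)].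
Proof.
rewrite /= big_split_ord; congr (_ + _); apply: eq_bigr => i _; rewrite ffunE /cat_tuple.
  by rewrite (unsplitK (inl i)).
by rewrite (unsplitK (inr i)).
Qed.

Lemma lincomb_cat_vec N n k (b : 'I_n -> N) (c : 'I_k -> N) (r : free R n) (s : free R k) :
  lincomb (cat_tuple b c) [ffun i => cat_tuple r s i] = lincomb b r + lincomb c s.
Proof.
pose t : free R (n + k) := [ffun i => cat_tuple r s i].
have tr : [ffun i => t (lshift k i)] = r :> free R n.
  by apply/ffunP => q; rewrite !ffunE /cat_tuple (unsplitK (inl q)).
have ts : [ffun i => t (rshift n i)] = s :> free R k.
  by apply/ffunP => q; rewrite !ffunE /cat_tuple (unsplitK (inr q)).
by rewrite -/t lincomb_cat tr ts.
Qed.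

Definition adjoin B (G : B -> E -> Prop) (b0 : B) (c : E) (x : B) (y : E) : Prop :=
  exists t x' y', [/\ G x' y', x = t *: b0 + x' & y = t *: c + y'].

Lemma solution_adjoin B (G : B -> E -> Prop) b0 c n (b : 'I_n -> B) w :
  solution G (cons_tuple b0 b) (cons_tuple c w) -> solution (adjoin G b0 c) b w.
Proof.
move=> S r _ _ [t [x [y [Gxy -> ->]]]] rx.
pose r' : free R n.+1 := [ffun i => cons_tuple (t : R^o) r i].
have r'E N (z : N) (u : 'I_n -> N) : lincomb (cons_tuple z u) r' = t *: z + lincomb u r.
  rewrite lincomb_cons ffunE {1}/cons_tuple unlift_none; congr (_ + lincomb u _).
  by apply/ffunP => i; rewrite !ffunE /cons_tuple liftK.
have := S r' x y Gxy; rewrite !r'E -!addrA => S'.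
by rewrite addrCA; apply: S'; rewrite addrCA.
Qed.

(** For each tuple [b], the values [c] at [b0] that belong to a solution for [(b0, b)] form a
    nonempty affine set. Concatenation of tuples makes this family directed, so one [c] serves all
    tuples. *)
Lemma extendable_adjoin B (G : B -> E -> Prop) b0 : extendable G ->
  exists c, extendable (adjoin G b0 c).
Proof.
move=> Gext; have [G0 GP GS] := Gext.
have cons_cat n k (b : 'I_n -> B) (b' : 'I_k -> B) c w :
    solution G (cons_tuple b0 (cat_tuple b b')) (cons_tuple c w) ->
    solution G (cons_tuple b0 b) (cons_tuple c (fun j => w (lshift k j))) /\
    solution G (cons_tuple b0 b') (cons_tuple c (fun j => w (rshift n j))).
  move=> S.
  have catE N (u : 'I_n -> N) (u' : 'I_k -> N) t (r : free R n) (r' : free R k) z :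
      lincomb (cons_tuple z (cat_tuple u u'))
        [ffun i => cons_tuple (t : R^o) (cat_tuple r r') i] =
      t *: z + (lincomb u r + lincomb u' r').
    rewrite lincomb_cons ffunE {1}/cons_tuple unlift_none -lincomb_cat_vec.
    by congr (_ + lincomb _ _); apply/ffunP => i; rewrite !ffunE /cons_tuple liftK.
  have wE r : lincomb (cons_tuple c w) r =
      lincomb (cons_tuple c (cat_tuple (fun j => w (lshift k j)) (fun j => w (rshift n j)))) r.
    rewrite !lincomb_cons; congr (_ + _); apply: eq_bigr => i _; congr (_ *: _).
    by rewrite /cat_tuple; case: splitP => j ij /=; congr (w _); apply: val_inj.
  split=> r x y Gxy; rewrite lincomb_cons => rx.
    have := S [ffun i => cons_tuple (r ord0)
      (cat_tuple [ffun j => r (lift ord0 j)] (0 : free R k)) i] x y Gxy.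
    by rewrite wE !catE !linear0 !addr0 lincomb_cons; apply.
  have := S [ffun i => cons_tuple (r ord0)
    (cat_tuple (0 : free R n) [ffun j => r (lift ord0 j)]) i] x y Gxy.
  by rewrite wE !catE !linear0 !add0r lincomb_cons; apply.
have [||c cP] := LCE
  (F := fun S => exists n (b : 'I_n -> B), S = (fun c => exists w,
     solution G (cons_tuple b0 b) (cons_tuple c w))).
- split; first by eexists; exists 0%N, (fun=> 0).
  move=> _ _ [n [b ->]] [k [b' ->]]; eexists; split; first by exists _, (cat_tuple b b').
    by move=> c [w /cons_cat [S _]]; eexists; exact: S.
  by move=> c [w /cons_cat [_ S]]; eexists; exact: S.
- move=> _ [n [b ->]]; split.
  + move=> a c1 c2 c3 [w1 S1] [w2 S2] [w3 S3].
    exists (fun i => w1 i + a *: (w2 i - w3 i)).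
    have := @solution_affine _ _ _ _ a _ _ _
      (solution_ffun S1) (solution_ffun S2) (solution_ffun S3).
    move=> S r x y Gxy /(S _ _ _ Gxy) <-; congr (_ + _).
    apply: eq_bigr => i _; rewrite !ffunE /cons_tuple.
    by case: unlift.
  + have [w Sw] := GS _ (cons_tuple b0 b); exists (w ord0), (w \o lift ord0).
    move=> r x y Gxy /(Sw _ _ _ Gxy) <-; congr (_ + _).
    by apply: eq_bigr => i _; rewrite /cons_tuple; case: unliftP => [j ->|->].
  + by move=> x y Sx /eqP; rewrite subr_eq0 => /eqP ->.
exists c; split.
- by exists 0, 0, 0; split=> //; rewrite scale0r addr0.
- move=> a x y x' y' [t [u [v [Guv -> ->]]]] [t' [u' [v' [Guv' -> ->]]]].
  exists (a * t + t'), (a *: u + u'), (a *: v + v'); split; first exact: GP.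
    by rewrite scalerDr scalerDl scalerA addrACA.
  by rewrite scalerDr scalerDl scalerA addrACA.
move=> n b; have [w Sw] := cP _ (ex_intro _ n (ex_intro _ b erefl)).
by exists w; apply: solution_adjoin.
Qed.

Lemma extendable_linear B (G0 : B -> E -> Prop) : extendable G0 ->
  exists h : {linear B -> E}, forall x y, G0 x y -> h x = y.
Proof.
move=> G0ext; pose T := {G | extendable G /\ forall x y, G0 x y -> G x y}.
pose le (G H : T) := `[< forall x y, sval G x y -> sval H x y >].
have [|||[G [Gext G0G]] Gmax] := @classical_sets.ZL_preorder T
  (exist _ G0 (conj G0ext (fun x y H => H))) le.
- by move=> G; apply/asboolP.
- by move=> G H K /asboolP GH /asboolP HK; apply/asboolP => x y /GH /HK.
- move=> A Atot; have [[H0 AH0]|nA] := pselect (exists H, A H); last first.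
    exists (exist _ G0 (conj G0ext (fun x y H => H))) => H AH.
    by case: nA; exists H.
  pose U x y := exists G, (exists2 H, A H & sval H = G) /\ G x y.
  have Uext : extendable U.
    apply: extendable_chain; first by exists (sval H0), H0.
      by move=> _ [[H [Hext HG]] AH <-].
    by move=> _ _ [H AH <-] [H' AH' <-]; have [/asboolP|/asboolP] := Atot H H' AH AH'; auto.
  have G0U x y : G0 x y -> U x y.
    by move=> Gxy; exists (sval H0); split; [exists H0 | apply: (svalP H0).2].
  exists (exist _ U (conj Uext G0U)) => H AH; apply/asboolP => x y Hxy.
  by exists (sval H); split=> //; exists H.
have [GG GP GS] := Gext.
have Gtot x : exists y, G x y.
  have [c cext] := extendable_adjoin x Gext; exists c.
  have GC u v : G u v -> adjoin G x c u v.
    by move=> Guv; exists 0, u, v; rewrite !scale0r !add0r.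
  have := Gmax (exist _ _ (conj cext (fun u v H => GC u v (G0G u v H)))).
  move=> /(_ (asboolT GC)) /asboolP /=; apply.
  by exists 1, 0, 0; rewrite !scale1r !addr0.
have G_fun y : G 0 y -> y = 0.
  (* Solvability for the empty tuple says that 0 has no image but 0. *)
  have [w Sw] := GS 0%N (fun=> 0); move=> G0y.
  by have := Sw 0 0 y G0y; rewrite !linear0 !add0r; apply.
have [h hP] := exists_linear Gtot G_fun (fun a u u' v v' => @GP a u v u' v').
exists h => x y /G0G Gxy; apply/eqP; rewrite -subr_eq0; apply/eqP/G_fun.
have := GP (-1) _ _ _ _ Gxy (hP x); rewrite !scaleN1r addNr.
by rewrite addrC.
Qed.

Lemma factors_through_ext_vanish M : factors_through M -> ext_vanish E 0 M.
Proof.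
move=> FM A B f g fg h; have [fI gE gS] := fg.
have [|h' h'P] := @extendable_linear B (fun x y => exists a, f a = x /\ h a = y).
- split.
  + by exists 0; rewrite !linear0.
  + by move=> c x y x' y' [a [<- <-]] [a' [<- <-]]; exists (c *: a + a'); rewrite !linearP.
  (* Over [X] the map [h] extends to the pullback [D], as Ext^1(X, E) = 0, and the tuple lifts to
     [y] in [D]. A relation between the [b j] and [A] gives one among the [x j], so it holds in [D]
     as well, and the images of [y] solve the system. *)
  + move=> n b; have [X [x [v [CX vx xr]]]] := factors_through_tuple (g \o b) FM.
    have [D [p [q D_pb]]] := exists_pullback g v.
    have [s [sq ps]] := se_pullback fg D_pb.
    have [u us] := CE CX sq h.
    have [y yP] := choice (fun j => pullback_ex D_pb (esym (vx j))).
    exists (u \o y) => r _ _ [a [<- <-]] ra.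
    have -> : lincomb (u \o y) r = u (lincomb y r).
      by rewrite /= linear_sum; apply: eq_bigr => i _; rewrite linearZ.
    rewrite -us -linearD.
    have -> : lincomb y r + s a = 0; last by rewrite linear0.
    apply: (pullback_inj D_pb); rewrite linearD.
      rewrite ps -[RHS]ra; congr (_ + _).
      by rewrite /= linear_sum; apply: eq_bigr => i _; rewrite linearZ (yP i).1.
    rewrite (se0 a sq) addr0.
    transitivity (lincomb x r).
      by rewrite /= linear_sum; apply: eq_bigr => i _; rewrite linearZ (yP i).2.
    apply: xr; transitivity (g (lincomb b r)).
      by rewrite /= linear_sum; apply: eq_bigr => i _; rewrite linearZ.
    by rewrite -[lincomb b r](addrK (f a)) ra sub0r linearN (se0 a fg) oppr0.
by exists h' => x; apply: h'P; exists x.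
Qed.
End FactorThrough.

(** * Direct limits and the factorization property *)

Section ProductModule.
Variables (R : comNzRingType) (I : Type) (V : I -> lmodType R).

Definition prodmod : Type := forall i, V i.

HB.instance Definition _ := gen_eqMixin prodmod.
HB.instance Definition _ := gen_choiceMixin prodmod.

Lemma prodmod_eq (x y : prodmod) : (forall i, x i = y i) -> x = y.
Proof. exact: functional_extensionality_dep. Qed.

Definition prodmod_zero : prodmod := fun=> 0.
Definition prodmod_opp (x : prodmod) : prodmod := fun i => - x i.
Definition prodmod_add (x y : prodmod) : prodmod := fun i => x i + y i.
Definition prodmod_scale (a : R) (x : prodmod) : prodmod := fun i => a *: x i.

Lemma prodmod_addA : associative prodmod_add.
Proof. by move=> x y z; apply: prodmod_eq => i; rewrite /prodmod_add addrA. Qed.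
Lemma prodmod_addC : commutative prodmod_add.
Proof. by move=> x y; apply: prodmod_eq => i; rewrite /prodmod_add addrC. Qed.
Lemma prodmod_add0 : left_id prodmod_zero prodmod_add.
Proof. by move=> x; apply: prodmod_eq => i; rewrite /prodmod_add add0r. Qed.
Lemma prodmod_addN : left_inverse prodmod_zero prodmod_opp prodmod_add.
Proof. by move=> x; apply: prodmod_eq => i; rewrite /prodmod_add addNr. Qed.

HB.instance Definition _ := GRing.isZmodule.Build prodmod
  prodmod_addA prodmod_addC prodmod_add0 prodmod_addN.

Lemma prodmod_scaleA a b x :
  prodmod_scale a (prodmod_scale b x) = prodmod_scale (a * b) x.
Proof. by apply: prodmod_eq => i; rewrite /prodmod_scale scalerA. Qed.
Lemma prodmod_scale1 : left_id 1 prodmod_scale.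
Proof. by move=> x; apply: prodmod_eq => i; rewrite /prodmod_scale scale1r. Qed.
Lemma prodmod_scaleDr : right_distributive prodmod_scale +%R.
Proof. by move=> a x y; apply: prodmod_eq => i; rewrite /prodmod_scale scalerDr. Qed.
Lemma prodmod_scaleDl x : {morph prodmod_scale^~ x : a b / a + b}.
Proof. by move=> a b; apply: prodmod_eq => i; rewrite /prodmod_scale scalerDl. Qed.

HB.instance Definition _ := GRing.Zmodule_isLmodule.Build R prodmod
  prodmod_scaleA prodmod_scale1 prodmod_scaleDr prodmod_scaleDl.
End ProductModule.

Section DirectLimitFactor.
Variables (R : comNzRingType) (C : lmodType R -> Prop) (D : direct_system R).
Variables (M : lmodType R) (g : forall i, {linear D i -> M}).
Hypothesis limM : is_direct_limit g.

(** The union of the images is a submodule by directedness; the projection modulo it and the zero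
    map induce the same cocone, hence coincide. *)
Lemma direct_limit_surj x : exists i y, g i y = x.
Proof.
have [gc gU] := limM.
have [||Q [p [_ pE]]] := @exists_quotient R M (fun x => exists i y, g i y = x).
- by have [i] := ds_inhabited D; exists i, 0; rewrite linear0.
- move=> a _ _ [i [y <-]] [j [z <-]]; have [k [ik jk]] := ds_directed i j.
  by exists k, (a *: ds_map ik y + ds_map jk z); rewrite linearP !gc.
have [|u [uE uU]] := gU Q (fun i => \0); first by move=> i j h y.
have up : u = p.
  by apply: uU => i y; apply/pE; exists i, y.
have u0 : u = \0 by apply: uU.
by apply/pE; rewrite -up u0.
Qed.

(* The cocone into the product of the D j modulo the families that vanish
   eventually detects the elements killed in the limit. *)
Lemma direct_limit_ker i (x : D i) : g i x = 0 -> exists j (h : ds_le i j), ds_map h x = 0.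
Proof.
have [gc gU] := limM; move=> gx.
pose V : lmodType R := prodmod (fun j => D j).
have [||Q [p [_ pE]]] := @exists_quotient R V (fun z => exists k, forall j, ds_le k j -> z j = 0).
- by have [k] := ds_inhabited D; exists k.
- move=> a u v [k ku] [l lv]; have [n [kn ln]] := ds_directed k l.
  exists n => j nj.
  rewrite -[LHS]/(a *: u j + v j) ku ?lv ?scaler0 ?addr0 //; apply: ds_le_trans nj; exact.
pose t l : D l -> V := fun y j => if pselect (ds_le l j) is left h then ds_map h y else 0.
have tE l j (h : ds_le l j) y : t l y j = ds_map h y.
  by rewrite /t; case: pselect => // h'; congr (ds_map _ y); apply: Prop_irrelevance.
have tL l : linear (t l).
  move=> a y z; apply: prodmod_eq => j; rewrite -[RHS]/(a *: t l y j + t l z j) /t.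
  by case: pselect => h; rewrite ?linearP // scaler0 addr0.
have [|u [uE _]] := gU Q (fun l => p \o lin_of (tL l) : {linear D l -> Q}).
  move=> l j h y; apply/eqP; rewrite -subr_eq0 /= -linearB; apply/eqP/pE.
  exists j => n jn; rewrite -[LHS]/(t j (ds_map h y) n - t l y n).
  by rewrite (tE _ _ jn) (tE _ _ (ds_le_trans h jn)) (ds_map_comp h jn (ds_le_trans h jn)) subrr.
have /esym := uE i x; rewrite gx linear0 => /pE [k kx].
have [j [ij kj]] := ds_directed i k.
by exists j, ij; rewrite -tE; apply: kx.
Qed.

Lemma direct_limit_lift n (c : 'I_n -> M) :
  exists i (y : 'I_n -> D i), forall j, g i (y j) = c j.
Proof.
have [gc _] := limM; elim: n c => [|n IH] c.
  by have [i] := ds_inhabited D; exists i, (fun=> 0) => -[].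
have [i [y yE]] := IH (c \o lift ord0); have [j [z zE]] := direct_limit_surj (c ord0).
have [k [ik jk]] := ds_directed i j.
exists k, (cons_tuple (ds_map jk z) (fun l => ds_map ik (y l))) => l; rewrite /cons_tuple.
by case: unliftP => [l' ->|->]; rewrite gc.
Qed.

Lemma direct_limit_kill i n (z : 'I_n -> D i) : (forall l, g i (z l) = 0) ->
  exists j (h : ds_le i j), forall l, ds_map h (z l) = 0.
Proof.
elim: n z => [|n IH] z gz; first by exists i, (ds_le_refl i) => -[].
have [j [ij jz]] := IH (z \o lift ord0) (fun l => gz _).
have [k [ik kz]] := direct_limit_ker (gz ord0).
have [l [jl kl]] := ds_directed j k; exists l, (ds_le_trans ij jl) => l'.
have [l'' ->|->] := unliftP ord0 l'.
  rewrite -(ds_map_comp ij jl) -[z _]/((z \o lift ord0) l'') jz.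
  exact: linear0.
have -> : ds_le_trans ij jl = ds_le_trans ik kl by apply: Prop_irrelevance.
by rewrite -(ds_map_comp ik kl) kz linear0.
Qed.

(** [F] is finitely presented: generators lift to one stage, and a later stage kills the finitely
    many relations. *)
Lemma direct_limit_factors_through :
  noetherian R -> (forall i, C (D i)) -> factors_through C M.
Proof.
move=> noethR CD F phi /fin_genP [n [p pS]]; have [gc _] := limM.
have [i [y yE]] := direct_limit_lift (fun j => phi (p (unit_vec R j))).
have [K [k kp]] := exists_presentation pS; have [kI pE _] := kp.
have [s [q qS]] := (fin_genP _).1 (fin_gen_sub noethR (fin_gen_free R n) kI).
have gyE r : g i (lincomb y r) = phi (p r).
  have -> : phi (p r) = (phi \o p : {linear free R n -> M}) r by [].
  rewrite [RHS]lincomb_linear /= linear_sum.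
  by apply: eq_bigr => j _; rewrite linearZ yE.
have [|j [h hz]] := @direct_limit_kill i s (fun l => lincomb y (k (q (unit_vec R l)))).
  by move=> l; rewrite gyE (se0 _ kp) linear0.
have [r /pE [z <-]|a aE] := factor_surj
  (f := (ds_map h \o lincomb y : {linear free R n -> D j})) pS.
  have [r' <-] := qS z.
  suff : (ds_map h \o lincomb y \o k \o q : {linear free R s -> D j}) r' = 0 by [].
  by rewrite lincomb_linear /= big1 // => l _; rewrite hz scaler0.
exists (D j), a, (g j); split=> // x; have [r <-] := pS x.
by rewrite aE /= gc -gyE.
Qed.
End DirectLimitFactor.

(** * Lenzing's criterion: a direct system of subquotients of one module *)

Section LazardSystem.
Variables (R : comNzRingType) (C : lmodType R -> Prop) (M V : lmodType R).
Variable pi : {linear V -> M}.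
Implicit Types X Y : lmodType R.

Definition is_submodule (P : V -> Prop) : Prop :=
  P 0 /\ forall a x y, P x -> P y -> P (a *: x + y).

(* A finitely generated submodule A of V and a submodule S of A killed by pi
   stand for the module A/S over M. *)
Record piece := Piece {
  piece_gen : V -> Prop;
  piece_rel : V -> Prop;
  piece_gen_sub : is_submodule piece_gen;
  piece_rel_sub : is_submodule piece_rel;
  piece_rel_gen : forall x, piece_rel x -> piece_gen x;
  piece_rel_ker : forall x, piece_rel x -> pi x = 0;
  piece_fg : exists n (g : 'I_n -> V),
    forall x, piece_gen x <-> exists r : free R n, lincomb g r = x
}.

(** The class map is a total function on [V], linear only on [A], so that classes can be written
    without membership proofs. *)
Lemma exists_subquotient (A S : V -> Prop) :
    is_submodule A -> is_submodule S -> (forall x, S x -> A x) ->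
  exists (X : lmodType R) (c : V -> X),
    [/\ forall a x y, A x -> A y -> c (a *: x + y) = a *: c x + c y,
        forall q, exists x, A x /\ c x = q & forall x, A x -> (c x = 0 <-> S x)].
Proof.
move=> [A0 AP] [S0 SP] SA; have [K [i [iI iE]]] := exists_submodule A0 AP.
have [||X [p [pS pE]]] := @exists_quotient R K (fun k => S (i k)).
- by rewrite linear0.
- by move=> a u v Su Sv; rewrite linearP; apply: SP.
have [k kP] : {k : V -> K & forall x, A x -> i (k x) = x}.
  apply: (choice (P := fun x k => A x -> i k = x)) => x.
  by have [/iE [k <-]|] := pselect (A x); [exists k | exists 0].
exists X, (p \o k); split=> [a x y Ax Ay|q|x Ax] /=.
- rewrite -linearP; congr (p _); apply: iI.
  by rewrite linearP !kP //; apply: AP.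
- have [y <-] := pS q; have Aiy : A (i y) by apply/iE; exists y.
  by exists (i y); split=> //; congr (p _); apply: iI; rewrite kP.
- by rewrite pE kP.
Qed.

Definition piece_data (i : piece) :=
  cid (exists_subquotient (piece_gen_sub i) (piece_rel_sub i) (@piece_rel_gen i)).

Definition piece_obj (i : piece) : lmodType R := sval (piece_data i).
Definition piece_cls (i : piece) : V -> piece_obj i := sval (cid (svalP (piece_data i))).

Lemma piece_clsP (i : piece) :
  [/\ forall a x y, piece_gen i x -> piece_gen i y ->
        piece_cls i (a *: x + y) = a *: piece_cls i x + piece_cls i y,
      forall q, exists x, piece_gen i x /\ piece_cls i x = q &
      forall x, piece_gen i x -> (piece_cls i x = 0 <-> piece_rel i x)].
Proof. exact: (svalP (cid (svalP (piece_data i)))). Qed.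

Lemma piece_lift (i : piece) Y (t : V -> Y) :
    (forall a x y, piece_gen i x -> piece_gen i y -> t (a *: x + y) = a *: t x + t y) ->
    (forall x, piece_rel i x -> t x = 0) ->
  exists f : {linear piece_obj i -> Y}, forall x, piece_gen i x -> f (piece_cls i x) = t x.
Proof.
move=> tL t0; have [cL cS cE] := piece_clsP i; have [A0 AP] := piece_gen_sub i.
have [|_ [x [Ax [c0 <-]]]||f fP] := @exists_linear R _ Y
  (fun q y => exists x, piece_gen i x /\ (piece_cls i x = q /\ t x = y)).
- by move=> q; have [x [Ax <-]] := cS q; exists (t x), x.
- by apply: t0; apply/cE.
- move=> a _ _ _ _ [x [Ax [<- <-]]] [x' [Ax' [<- <-]]].
  by exists (a *: x + x'); rewrite cL // tL //; split=> //; apply: AP.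
exists f => x Ax; have [y [Ay [cy <-]]] := fP (piece_cls i x).
have yx : piece_rel i (-1 *: x + y).
  by apply/cE; [apply: AP | rewrite cL // cy scaleN1r addNr].
by have /eqP := t0 _ yx; rewrite tL // scaleN1r addrC subr_eq0 => /eqP.
Qed.

Lemma piece_to_ex (i : piece) : exists f : {linear piece_obj i -> M},
  forall x, piece_gen i x -> f (piece_cls i x) = pi x.
Proof. by apply: piece_lift => [a x y _ _|]; [rewrite linearP | exact: piece_rel_ker]. Qed.

Definition piece_to i := sval (cid (piece_to_ex i)).
Lemma piece_toE i x : piece_gen i x -> piece_to i (piece_cls i x) = pi x.
Proof. exact: (svalP (cid (piece_to_ex i))). Qed.

Definition piece_le (i j : piece) : Prop :=
  (forall x, piece_gen i x -> piece_gen j x) /\ (forall x, piece_rel i x -> piece_rel j x).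

Lemma piece_map_ex (i j : piece) (h : piece_le i j) :
  exists f : {linear piece_obj i -> piece_obj j},
    forall x, piece_gen i x -> f (piece_cls i x) = piece_cls j x.
Proof.
have [Aij Sij] := h; have [cL _ cE] := piece_clsP j.
apply: piece_lift => [a x y Ax Ay|x Sx]; first by apply: cL; apply: Aij.
by apply/cE; [apply/Aij/piece_rel_gen | apply: Sij].
Qed.

Definition piece_map i j (h : piece_le i j) := sval (cid (piece_map_ex h)).
Lemma piece_mapE i j (h : piece_le i j) x :
  piece_gen i x -> piece_map h (piece_cls i x) = piece_cls j x.
Proof. exact: (svalP (cid (piece_map_ex h))). Qed.

Lemma piece_sum (i j : piece) : exists k, piece_le i k /\ piece_le j k.
Proof.
have [[A0 AP] [S0 SP]] := (piece_gen_sub i, piece_rel_sub i).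
have [[A'0 A'P] [S'0 S'P]] := (piece_gen_sub j, piece_rel_sub j).
pose sum (P Q : V -> Prop) x := exists y z, [/\ P y, Q z & x = y + z].
have sum_sub P Q : is_submodule P -> is_submodule Q -> is_submodule (sum P Q).
  move=> [P0 PP] [Q0 QP]; split; first by exists 0, 0; rewrite addr0.
  move=> a _ _ [y [z [Py Qz ->]]] [y' [z' [Py' Qz' ->]]].
  exists (a *: y + y'), (a *: z + z'); split; [exact: PP | exact: QP |].
  by rewrite scalerDr addrACA.
have ker x : sum (piece_rel i) (piece_rel j) x -> pi x = 0.
  move=> [y [z [Sy Sz ->]]].
  by rewrite linearD (piece_rel_ker Sy) (piece_rel_ker Sz) addr0.
have gen x : sum (piece_rel i) (piece_rel j) x -> sum (piece_gen i) (piece_gen j) x.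
  by move=> [y [z [Sy Sz ->]]]; exists y, z; split=> //; apply: piece_rel_gen.
have fg : exists n (g : 'I_n -> V),
    forall x, sum (piece_gen i) (piece_gen j) x <-> exists r : free R n, lincomb g r = x.
  have [[n [g gE]] [l [h hE]]] := (piece_fg i, piece_fg j).
  exists (n + l)%N, (cat_tuple g h) => x; split=> [[y [z [/gE [r <-] /hE [s <-] ->]]]|[r <-]].
    by exists [ffun q => cat_tuple r s q]; rewrite lincomb_cat_vec.
  rewrite lincomb_cat; do 2 eexists; split; last by [].
    by apply/gE; eexists.
  by apply/hE; eexists.
exists (Piece (sum_sub _ _ (piece_gen_sub i) (piece_gen_sub j))
  (sum_sub _ _ (piece_rel_sub i) (piece_rel_sub j)) gen ker fg).
split; split=> x Px /=; [exists x, 0 | exists x, 0 | exists 0, x | exists 0, x];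
  by rewrite ?addr0 ?add0r.
Qed.

(** [room] supplies preimages of a finite tuple that are free modulo any given finitely generated
    submodule: pieces are ordered by inclusion, so a module of [C] must be rebuilt inside [V] around
    a given piece. The copy is only isomorphic to the original, hence [C_iso]. *)
Hypotheses (C_fg : forall X, C X -> fin_gen X)
  (C_iso : forall X Y (f : {linear X -> Y}), injective f -> surj f -> C X -> C Y)
  (FM : factors_through C M)
  (room : forall n (g : 'I_n -> V) k (y : 'I_k -> M), exists e : 'I_k -> V,
     (forall j, pi (e j) = y j) /\
     forall (r : free R n) (s : free R k), lincomb g r + lincomb e s = 0 -> s = 0).

(** The map from the piece to [M] factors through some [X] in [C]. Fresh vectors [e j] over the
    images of generators of [X] are added, with all relations that hold in [X]; the enlarged piece
    is isomorphic to [X]. *)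
Lemma piece_cofinal (i : piece) : exists j, piece_le i j /\ C (piece_obj j).
Proof.
have [cL cS cE] := piece_clsP i; have [n [g gE]] := piece_fg i.
have [[A0 AP] [S0 SP]] := (piece_gen_sub i, piece_rel_sub i).
have Ag r : piece_gen i (lincomb g r) by apply/gE; exists r.
have fgi : fin_gen (piece_obj i).
  have L : linear (fun r : free R n => piece_cls i (lincomb g r)).
    by move=> a r s; rewrite linearP cL.
  apply/fin_genP; exists n, (lin_of L) => q; have [x [/gE [r <-] <-]] := cS q.
  by exists r.
have [X [phi [v [CX vphi]]]] := FM (piece_to i) fgi.
have [k [x xP]] := C_fg CX.
have [e [ve eI]] := room g (fun j => v (x j)).
have pie s : pi (lincomb e s) = v (lincomb x s).
  by rewrite /= !linear_sum; apply: eq_bigr => j _; rewrite !linearZ ve.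
(* Freshness of [e] makes the decomposition of an element of the new piece unique. *)
have dec a a' s s' : piece_gen i a -> piece_gen i a' ->
    a + lincomb e s = a' + lincomb e s' -> a = a' /\ s = s'.
  move=> /gE [r <-] /gE [r' <-] E.
  have ss' : s - s' = 0.
    apply: (eI (r - r')); rewrite !linearB addrACA E -opprD.
    exact: subrr.
  have {ss'}ss' : s = s' by apply/eqP; rewrite -subr_eq0 ss'.
  by split=> //; move: E; rewrite ss' => /addIr.
pose A y := exists a s, piece_gen i a /\ y = a + lincomb e s.
pose S y := exists a s, [/\ piece_gen i a, y = a + lincomb e s &
                             phi (piece_cls i a) + lincomb x s = 0].
have A_sub : is_submodule A.
  split; first by exists 0, 0; rewrite linear0 addr0.
  move=> b _ _ [a [s [Aa ->]]] [a' [s' [Aa' ->]]].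
  exists (b *: a + a'), (b *: s + s'); split; first exact: AP.
  by rewrite linearP scalerDr addrACA.
have S_sub : is_submodule S.
  split.
    by exists 0, 0; rewrite !linear0 !addr0; split=> //; rewrite (cE 0 A0).2 // linear0.
  move=> b _ _ [a [s [Aa -> E]]] [a' [s' [Aa' -> E']]].
  exists (b *: a + a'), (b *: s + s'); split; [exact: AP| |].
    by rewrite linearP scalerDr addrACA.
  by rewrite cL // !linearP addrACA -scalerDr E E' scaler0 addr0.
have SA y : S y -> A y by move=> [a [s [Aa -> _]]]; exists a, s.
have S_ker y : S y -> pi y = 0.
  move=> [a [s [Aa -> E]]]; rewrite linearD pie -(piece_toE Aa) -vphi -linearD E.
  exact: linear0.
have A_fg : exists n (g : 'I_n -> V), forall y, A y <-> exists r : free R n, lincomb g r = y.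
  exists (n + k)%N, (cat_tuple g e) => y; split=> [[a [s [/gE [r <-] ->]]]|[r <-]].
    by exists [ffun q => cat_tuple r s q]; rewrite lincomb_cat_vec.
  by rewrite lincomb_cat; do 2 eexists; split; last by [].
pose j := Piece A_sub S_sub SA S_ker A_fg.
exists j; split.
  split=> y Py /=; first by exists y, 0; rewrite linear0 addr0.
  exists y, 0; rewrite !linear0 !addr0; split=> //; first exact: piece_rel_gen.
  by rewrite (cE y _).2 ?linear0 //; apply: piece_rel_gen.
have [c'L c'S c'E] := piece_clsP j.
have [z|q [a [s [Aa /esym E ->]]]||f fP] := @exists_linear R X (piece_obj j)
  (fun z q => exists a s, [/\ piece_gen i a, z = phi (piece_cls i a) + lincomb x s
     & q = piece_cls j (a + lincomb e s)]).
- have [r ->] := xP z; exists (piece_cls j (lincomb e [ffun l => r l])), 0, [ffun l => r l].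
  split; rewrite ?add0r //; rewrite (cE 0 A0).2 // linear0 add0r /=.
  by apply: eq_bigr => l _; rewrite ffunE.
- by apply/c'E; exists a, s.
- move=> b _ _ _ _ [a [s [Aa -> ->]]] [a' [s' [Aa' -> ->]]].
  exists (b *: a + a'), (b *: s + s'); split; first exact: AP.
    by rewrite cL // !linearP scalerDr addrACA.
  rewrite -c'L; [|by exists a, s|by exists a', s'].
  by rewrite linearP scalerDr addrACA.
apply: (C_iso (f := f)) CX.
  apply: linear_inj0 => z fz; have [a [s [Aa zE E]]] := fP z; rewrite zE.
  move: E; rewrite fz => /esym /c'E; case; first by exists a, s.
  by move=> a' [s' [Aa' /(dec _ _ _ _ Aa Aa') [-> ->]]].
move=> q; have [_ [[a [s [Aa ->]]] <-]] := c'S q.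
exists (phi (piece_cls i a) + lincomb x s).
have [a' [s' [Aa' E ->]]] := fP (phi (piece_cls i a) + lincomb x s).
apply/eqP; rewrite -subr_eq0 -scaleN1r addrC -c'L; [|by exists a, s|by exists a', s'].
apply/eqP/c'E; first by apply: A_sub.2; [exists a, s | exists a', s'].
exists (-1 *: a + a'), (-1 *: s + s'); split; first exact: AP.
  by rewrite linearP scalerDr addrACA.
by rewrite cL // !linearP addrACA -scalerDr -E scaleN1r addNr.
Qed.

Definition lazard_index : Type := {i : piece | C (piece_obj i)}.

Definition lazard_le (i j : lazard_index) : Prop := piece_le (sval i) (sval j).

Lemma lazard_le_refl i : lazard_le i i. Proof. by split. Qed.

Lemma lazard_le_trans i j k : lazard_le i j -> lazard_le j k -> lazard_le i k.
Proof. by move=> [ij ij'] [jk jk']; split=> x; auto. Qed.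

Lemma lazard_cofinal i : exists j : lazard_index, piece_le i (sval j).
Proof. by have [j [ij Cj]] := piece_cofinal i; exists (exist _ j Cj). Qed.

Lemma lazard_directed i j : exists k, lazard_le i k /\ lazard_le j k.
Proof.
have [k [[ik ik'] [jk jk']]] := piece_sum (sval i) (sval j).
have [l [kl kl']] := lazard_cofinal k.
by exists l; split; split=> x; auto.
Qed.

Lemma cyclic_piece_ex (x : V) : exists i, piece_gen i x.
Proof.
have As : is_submodule (fun y => exists r, r *: x = y).
  split; first by exists 0; rewrite scale0r.
  by move=> a _ _ [r <-] [s <-]; exists (a * r + s); rewrite scalerDl scalerA.
have Ss : is_submodule (fun y => y = 0).
  by split=> // a u v -> ->; rewrite scaler0 addr0.
unshelve eexists; first apply: (Piece As Ss) => [_ ->|_ ->|].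
- by exists 0; rewrite scale0r.
- exact: linear0.
- exists 1%N, (fun=> x) => y; split=> [[r <-]|[r <-]].
    by exists [ffun=> r]; rewrite /= big_ord1 ffunE.
  by exists (r ord0); rewrite /= big_ord1.
by exists 1; rewrite scale1r.
Qed.

Lemma lazard_inhabited : inhabited lazard_index.
Proof.
have [i _] := cyclic_piece_ex 0; have [j _] := lazard_cofinal i.
exact: inhabits j.
Qed.

Lemma lazard_map_id (i : lazard_index) (h : lazard_le i i) x : piece_map h x = x.
Proof.
by have [_ cS _] := piece_clsP (sval i); have [y [Ay <-]] := cS x; rewrite piece_mapE.
Qed.

Lemma lazard_map_comp (i j k : lazard_index) (ij : lazard_le i j) (jk : lazard_le j k)
  (ik : lazard_le i k) x : piece_map jk (piece_map ij x) = piece_map ik x.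
Proof.
have [_ cS _] := piece_clsP (sval i); have [y [Ay <-]] := cS x.
by rewrite !piece_mapE //; apply: ij.1.
Qed.

Definition lazard_system : direct_system R :=
  @DirectSystem R lazard_index lazard_le lazard_le_refl lazard_le_trans lazard_inhabited
    lazard_directed (fun i => piece_obj (sval i)) (fun i j h => piece_map h)
    lazard_map_id lazard_map_comp.

Lemma piece_kill (i : piece) z : piece_gen i z -> pi z = 0 ->
  exists j, piece_le i j /\ piece_rel j z.
Proof.
move=> Az pz; have [[A0 AP] [S0 SP]] := (piece_gen_sub i, piece_rel_sub i).
pose S y := exists r s, piece_rel i s /\ y = r *: z + s.
have Ss : is_submodule S.
  split; first by exists 0, 0; rewrite scale0r addr0.
  move=> a _ _ [r [s [Ss ->]]] [r' [s' [Ss' ->]]].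
  exists (a * r + r'), (a *: s + s'); split; first exact: SP.
  by rewrite scalerDr scalerDl scalerA addrACA.
have SA y : S y -> piece_gen i y.
  by move=> [r [s [/piece_rel_gen As ->]]]; apply: AP.
have S_ker y : S y -> pi y = 0.
  by move=> [r [s [Ss' ->]]]; rewrite linearP pz scaler0 add0r (piece_rel_ker Ss').
exists (Piece (piece_gen_sub i) Ss SA S_ker (piece_fg i)); split.
  by split=> // y Sy; exists 0, y; rewrite scale0r add0r.
by exists 1, 0; rewrite scale1r addr0.
Qed.

Lemma factors_through_direct_limits : direct_limits C M.
Proof.
exists lazard_system, (fun i : lazard_index => piece_to (sval i)).
split; first by move=> [].
have cocone : is_cocone (D := lazard_system) (fun i : lazard_index => piece_to (sval i)).
  move=> i j h x; have [_ cS _] := piece_clsP (sval i); have [y [Ay <-]] := cS x.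
  by rewrite /= piece_mapE // !piece_toE //; apply: h.1.
split=> // Y t tc.
have tot x : exists (i : lazard_index) q, piece_to (sval i) q = x.
  (* With nothing to be independent of, [room] provides just a preimage of [x] under [pi]. *)
  have [e [ve _]] := room (fun _ : 'I_0 => 0) (fun _ : 'I_1 => x).
  have [i Ai] := cyclic_piece_ex (e ord0); have [j [ij _]] := lazard_cofinal i.
  by exists j, (piece_cls (sval j) (e ord0)); rewrite piece_toE ?ve //; apply: ij.
have zero (i : lazard_index) q : piece_to (sval i) q = 0 -> t i q = 0.
  have [_ cS _] := piece_clsP (sval i); have [z [Az <-]] := cS q.
  rewrite piece_toE // => pz; have [j [[ij ij'] jz]] := piece_kill Az pz.
  have [k [jk jk']] := lazard_cofinal j.
  have ik : lazard_le i k by split=> y; auto.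
  rewrite -(tc i k ik) /= piece_mapE //.
  have [_ _ cE] := piece_clsP (sval k).
  by rewrite (cE z _).2 ?linear0 //; auto.
have [||| w wP] := @exists_linear R M Y
  (fun x y => exists (i : lazard_index) q, piece_to (sval i) q = x /\ t i q = y).
- by move=> x; have [i [q qx]] := tot x; exists (t i q), i, q.
- by move=> _ [i [q [/zero q0 <-]]].
- move=> a _ _ _ _ [i [q [<- <-]]] [j [q' [<- <-]]].
  have [k [ik jk]] := lazard_directed i j.
  exists k, (a *: piece_map ik q + piece_map jk q'); rewrite !linearP.
  by split; congr (_ *: _ + _);
    [apply: cocone ik _ | apply: cocone jk _ | apply: tc ik _ | apply: tc jk _].
have wE i x : w (piece_to (sval i) x) = t i x.
  have [j [q [E <-]]] := wP (piece_to (sval i) x).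
  have [k [ik jk]] := lazard_directed i j.
  rewrite -(tc _ _ ik) -(tc _ _ jk); apply/eqP; rewrite -subr_eq0 -linearB.
  apply/eqP/zero; rewrite linearB.
  rewrite -[piece_to _ _]/(piece_to (sval k) (ds_map (d := lazard_system) jk q)).
  by rewrite (cocone _ _ jk) (cocone _ _ ik) E subrr.
exists w; split=> // w' w'E; apply: (@homR_eq R M Y) => x.
by have [i [q <-]] := tot x; rewrite wE w'E.
Qed.
End LazardSystem.

(** Infinitely many basis vectors lie over each element of [M]. Those with second index at least [B]
    avoid the supports of the [g i], and adding [j] keeps them distinct when the [y j] repeat. *)
Lemma malg_room (R : comNzRingType) (M : lmodType R) :
  exists (V : lmodType R) (pi : {linear V -> M}),
  forall n (g : 'I_n -> V) k (y : 'I_k -> M), exists e : 'I_k -> V,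
     (forall j, pi (e j) = y j) /\
     (forall (r : free R n) (s : free R k), lincomb g r + lincomb e s = 0 -> s = 0).
Proof.
exists {malg R[(M * nat)%type]}, (lin_of (linear_sum_malg (fun z : M * nat => z.1))).
move=> n g k y.
pose B := \max_(i < n) \max_(z <- msupp (g i)) z.2.+1.
exists (fun j => << (y j, (B + j)%N) >>); split=> [j|r s E] /=.
  by rewrite msuppU oner_eq0 big_seq_fset1 mcoeffUU scale1r.
apply/ffunP => j; rewrite ffunE.
have := congr1 (mcoeff (y j, (B + j)%N)) E.
rewrite mcoeffD mcoeff0 /= !raddf_sum /= big1 ?add0r => [|i _].
  rewrite (bigD1 j) //= big1 ?addr0 => [|l lj]; rewrite mcoeffZ mcoeffU.
    by rewrite eqxx mulr1.
  rewrite (_ : (_ == _) = false) ?mulr0 //.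
  by apply/negbTE; apply: contraNneq lj => -[_ /addnI /val_inj ->].
rewrite mcoeffZ mcoeff_outdom ?mulr0 //; apply/negP => iB.
have : ((B + j).+1 <= B)%N.
  apply: leq_trans (leq_bigmax i).
  by rewrite (big_fsetD1 _ iB) /= leq_maxl.
by rewrite ltnNge leq_addr.
Qed.

(** * Duality *)

Section Duality.
Variables (R : comNzRingType) (m : idealr R) (d : nat) (Omega : lmodType R).
Implicit Types F K M P X Y : lmodType R.
Hypotheses (noethR : noetherian R) (localR : local_ring m) (completeR : adic_complete m).
Hypotheses (cmR : CM_module m d R^o) (canonicalOmega : canonical_module m d Omega).

Local Notation CM := (CM_module m d).

Lemma CM_iso X Y (f : {linear X -> Y}) : injective f -> surj f -> CM X -> CM Y.
Proof.
move=> fI fS cmX; have [x fx0|g gE] := factor_surj (f := (idfun : {linear X -> X})) fS.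
  by apply: fI; rewrite fx0 linear0.
(* [Y] is the kernel of [X -> R^0]. *)
apply: (CM_ker noethR (f := g) (g := \0 : {linear X -> free R 0}) _ cmX (CM_free cmR 0)).
split=> [y y'|x|z].
- have [x <-] := fS y; have [x' <-] := fS y'.
  by rewrite !gE /= => ->.
- by split=> // _; exists (f x); rewrite gE.
- by exists 0; apply/ffunP => -[].
Qed.

Lemma CM_pair X Y : CM X -> CM Y -> CM (X * Y)%type.
Proof.
move=> [fgX DX] [fgY DY]; split; first exact: fin_gen_pair.
exact: depth_ge_pair.
Qed.

Lemma malg_factors (I : choiceType) F (phi : {linear F -> {malg R[I]}}) : fin_gen F ->
  exists n (a : {linear F -> free R n}) (b : {linear free R n -> {malg R[I]}}),
    forall x, b (a x) = phi x.
Proof.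
move=> /fin_genP [k [p pS]].
pose D := (\bigcup_(i <- enum 'I_k) msupp (phi (p (unit_vec R i))))%fset.
pose s : seq I := D.
have aL : linear (fun z : {malg R[I]} =>
    [ffun i : 'I_(size s) => z@_(tnth (in_tuple s) i)] : free R (size s)).
  by move=> c z z'; apply/ffunP => i; rewrite !ffunE mcoeffD mcoeffZ.
pose a := lin_of aL.
pose b : {linear free R (size s) -> {malg R[I]}} :=
  lincomb (fun i => << tnth (in_tuple s) i >>).
have ba z : (msupp z `<=` D)%fset -> b (a z) = z.
  move=> zD; rewrite [RHS](monalgEw zD) [RHS]big_tnth /=; apply: eq_bigr => i _.
  by rewrite ffunE; apply/malgP => y; rewrite mcoeffZ !mcoeffU mulr_natr.
exists (size s), (a \o phi : {linear F -> free R (size s)}), b.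
apply: (linear_eq_generators (f := b \o (a \o phi) : {linear F -> {malg R[I]}}) pS) => i.
apply: (ba (phi (p (unit_vec R i)))).
by apply: bigfcup_sup; rewrite ?mem_enum.
Qed.

(** [F -> K] lands in a finite free part R^n of the free module, and the cokernel of [F -> R^n] maps
    to [M] through some [X] in CM. The syzygy [K'] of [X] then lies in CM and carries the
    factorization. *)
Lemma factors_through_syzygy (I : choiceType) K M (i : {linear K -> {malg R[I]}})
    (p : {linear {malg R[I]} -> M}) :
  short_exact i p -> factors_through CM M -> factors_through CM K.
Proof.
move=> ip FM F phi fgF; have [iI pE pS] := ip.
have [n [al [be beE]]] := malg_factors (i \o phi : {linear F -> {malg R[I]}}) fgF.
have [F' [q [qS qE]]] := exists_coker al.
have [x /qE [y <-]|u uE] := factor_surj (f := (p \o be : {linear free R n -> M})) qS.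
  by rewrite /= beE (se0 _ ip).
have [X [a [v [cmX vE]]]] := FM F' u (fin_gen_surj (f := q) (fin_gen_free R n) qS).
have [l [x xS]] := (fin_genP _).1 cmX.1.
have [ga gaE] := free_projective (v \o x : {linear free R l -> M}) pS.
(* The summand R^l only makes the map onto [X] surjective. *)
pose z : {linear (free R n * free R l)%type -> X} := copair_lin (a \o q) x.
have [|K' [j jz]] := @exists_presentation _ _ _ z.
  by move=> y; have [r <-] := xS y; exists (0, r); rewrite /= !linear0 add0r.
have [jI zE zS] := jz.
have [k|psi psiE] := @factor_inj _ K _ K' i
    (copair_lin be ga \o j : {linear K' -> {malg R[I]}}) iI.
  apply/pE; rewrite /= linearD gaE.
  have -> : p (be (j k).1) = v (a (q (j k).1)) by rewrite vE uE.
  rewrite /= -linearD; suff : v (z (j k)) = 0 by [].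
  by rewrite (se0 k jz) linear0.
have [f|th thE] := @factor_inj _ K' _ F j
    (inl_lin _ _ \o al : {linear F -> (free R n * free R l)%type}) jI.
  by apply/zE; rewrite /= (qE (al f)).2 ?linear0 ?addr0 //; exists f.
exists K', th, psi; split; last first.
  by move=> f; apply: iI; rewrite psiE /= thE /= linear0 addr0 beE.
by apply: (CM_ker noethR jz) => //; apply: CM_pair; apply: CM_free.
Qed.

Lemma factors_through_ext_vanish_Omega M : factors_through CM M -> ext_vanish Omega 0 M.
Proof.
apply: factors_through_ext_vanish.
  exact: (linearly_compact_fin_gen noethR localR completeR (fin_gen_Omega canonicalOmega)).
by move=> X cmX; apply: (CM_ext_vanish noethR localR cmR canonicalOmega).
Qed.

(** Depth 0 is no condition, so the induction starts with [F] itself. [M] has to vary, because the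
    step for [M] uses the syzygy [K]. *)
Lemma dual_factors_depth e M F (phi : {linear F -> homR M Omega}) :
    (e <= d)%N -> factors_through CM M -> fin_gen F ->
  exists Y (a : {linear F -> Y}) (v : {linear Y -> homR M Omega}),
    [/\ fin_gen Y, depth_ge m e Y & forall x, v (a x) = phi x].
Proof.
elim: e M F phi => [|e IH] M F phi ed FM fgF.
  by exists F, idfun, phi.
pose P : lmodType R := {malg R[M]}.
pose p : {linear P -> M} := @free_cover R M.
have pS : surj p := @free_cover_surj R M.
have [K [i ip]] := exists_presentation pS; have [iI pE _] := ip.
have fgO := fin_gen_Omega canonicalOmega.
have DO : depth_ge m d Omega by case: canonicalOmega => -[].
have FK := factors_through_syzygy ip FM.
pose res := precomp Omega i; pose dp := precomp Omega p.
have dpI : injective dp.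
  apply: linear_inj0 => h /homR0_eq h0; apply/homR0_eq => x.
  by have [y <-] := pS x; exact: h0.
(* Surjectivity of P^* -> K^* is Ext^1(M, Omega) = 0. *)
have resS : surj res.
  move=> h; have [g gE] := factors_through_ext_vanish_Omega FM ip h.
  by exists g; apply: homR_eq => x; rewrite -gE.
have resE h : res h = 0 -> exists g, dp g = h.
  move=> /homR0_eq h0; have [x /pE [y <-]|g gE] := factor_surj (f := h : {linear _ -> _}) pS.
    exact: h0.
  by exists g; apply: homR_eq => x; rewrite -gE.
have [n [sg sgS]] := (fin_genP _).1 (fin_gen_homR noethR fgF fgO).
(* By adjunction F -> P^* is a map from [P] to Hom(F, Omega), which has [n] generators; as [P] is
   free, it lifts to [c : P -> R^n]. Read backwards, this factors F -> P^* through Omega^n. *)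
have etaL : linear (fun x : P =>
    (homR_ev Omega (p x) \o phi : {linear F -> Omega}) : homR F Omega).
  by move=> c x y; apply: homR_eq => f; rewrite /= !linearP.
have [c cE] := malg_projective (lin_of etaL) sgS.
pose w : {linear F -> {ffun 'I_n -> Omega}} :=
  ffun_lin (fun k => (sg (unit_vec R k) : {linear F -> Omega})).
pose be : {linear {ffun 'I_n -> Omega} -> homR P Omega} :=
  precomp Omega c \o lincomb_homR n Omega.
have beE f : be (w f) = dp (phi f).
  apply: homR_eq => x; transitivity ((sg (c x) : homR F Omega) f); last by rewrite cE.
  rewrite (lincomb_linear sg) /= homR_sumE.
  by apply: eq_bigr => k _; rewrite /= ffunE.
have [F' [q [qS qE]]] := exists_coker w.
have resdp g : res (dp g) = 0.
  by apply: homR_eq => x; rewrite 2!precompE (se0 _ ip) linear0.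
have [y /qE [f <-]|be' be'E] := factor_surj (f := (res \o be : {linear _ -> homR K Omega})) qS.
  by suff : res (be (w f)) = 0 by []; rewrite beE resdp.
have fgOn : fin_gen {ffun 'I_n -> Omega} by apply: fin_gen_ffun.
have [Y' [a' [v' [fgY' DY' va']]]] := IH K F' be' (ltnW ed) FK (fin_gen_surj fgOn qS).
have [t [y yS]] := (fin_genP _).1 fgY'.
have [ga gaE] := free_projective (v' \o y : {linear free R t -> homR K Omega}) resS.
pose Z : lmodType R := ({ffun 'I_n -> Omega} * free R t)%type.
pose z : {linear Z -> Y'} := copair_lin (a' \o q) y.
have [|Y [j jz]] := @exists_presentation _ _ _ z.
  by move=> x; have [r <-] := yS x; exists (0, r); rewrite /= !linear0 add0r.
have [jI zE _] := jz.
(* On [Y] the composite with P^* -> K^* factors through [z] and so vanishes; hence the map to P^*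
   falls into M^*. *)
have [x|psi psiE] := @factor_inj _ _ _ Y dp
    (copair_lin be ga \o j : {linear Y -> homR P Omega}) dpI.
  apply: resE; suff : res (be (j x).1 + ga (j x).2) = 0 by [].
  have resbe : res (be (j x).1) = v' (a' (q (j x).1)) by rewrite va' be'E.
  rewrite linearD gaE resbe /= -linearD; suff : v' (z (j x)) = 0 by [].
  by rewrite (se0 x jz) linear0.
have [f|th thE] := @factor_inj _ Y Z F j (inl_lin _ _ \o w : {linear F -> Z}) jI.
  apply/zE; suff : a' (q (w f)) + y 0 = 0 by [].
  by rewrite (qE (w f)).2 ?linear0 ?addr0 //; exists f.
exists Y, th, psi; split.
- apply: (fin_gen_sub noethR _ jI); apply: fin_gen_pair => //; exact: fin_gen_free.
- apply: (depth_ge_sub jz) => //; apply: (depth_ge_le ed); apply: depth_ge_pair.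
    exact: depth_ge_ffun.
  by have [] := CM_free cmR t.
move=> f; apply: dpI; rewrite psiE -beE.
suff : be (j (th f)).1 + ga (j (th f)).2 = be (w f) by [].
by rewrite thE; suff : be (w f) + ga 0 = be (w f) by []; rewrite linear0 addr0.
Qed.

Lemma dual_factors_through M : factors_through CM M -> factors_through CM (homR M Omega).
Proof.
move=> FM F phi fgF; have [Y [a [v [fgY DY va]]]] := dual_factors_depth phi (leqnn d) FM fgF.
by exists Y, a, v; split.
Qed.

Lemma lim_CM_factors_through M : lim_CM m d M <-> factors_through CM M.
Proof.
split=> [[D [g [CD limM]]]|FM]; first exact: (direct_limit_factors_through limM noethR CD).
have [V [pi room]] := malg_room M.
apply: (factors_through_direct_limits _ _ FM room) => [X [] //|X Y f].
exact: CM_iso.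
Qed.
End Duality.

Theorem proposition3p9 (R : comNzRingType) (m : idealr R) (d : nat)
    (Omega : lmodType R)
    (noethR : noetherian R) (localR : local_ring m)
    (completeR : adic_complete m) (dimR : krull_dim R d)
    (cmR : CM_module m d R^o)
    (canonicalOmega : canonical_module m d Omega) :
  (forall M : lmodType R, lim_CM m d M -> lim_CM m d (homR M Omega)) /\
  injective_object (lim_CM m d) Omega.
Proof.
split=> [M|].
  rewrite !lim_CM_factors_through //.
  exact: dual_factors_through.
split=> [|L M N f g _ _ limN fg h].
  (* Omega lies in CM, so every map to it factors through Omega itself. *)
  apply/lim_CM_factors_through => // F phi fgF; exists Omega, phi, idfun; split=> //.
  exact: canonicalOmega.1.
have FN : factors_through (CM_module m d) N by apply/lim_CM_factors_through.
exact: (factors_through_ext_vanish_Omega noethR localR completeR cmR canonicalOmega FN fg h).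
Qed.
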